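(* There exists an absolute constant $c_0>0$ such that the following holds. Let $d\ge1$, $M>0$, let $k\ge3$ be an integer divisible by $3$, let $m=2k/3$, and let $n\ge 3k/2$. Set $$c_1=\frac{(5M)^2}{4\left(32\,m^{1/4+1/d}\right)^2}.$$ Then for any empirically designed codebook $\hat{\mathbf c}_n$, i.e. any (measurable) map from $(\mathbb R^d)^n$ to $(\mathbb R^d)^k$ evaluated at an i.i.d. sample $X_1,\dots,X_n$ with distribution $P$, $$\sup_{P\in\mathcal D(c_1/\sqrt n)}\mathbb E\,\ell(\hat{\mathbf c}_n,\mathbf c^* )\ \ge\ c_0M^2\,\frac{\sqrt{k^{1-4/d}}}{\sqrt n}.$$
   Context: Here $\mathcal H=\mathbb R^d$ with Euclidean norm. Codebooks are $\mathbf c=(c_1,\dots,c_k)\in(\mathbb R^d)^k$. For a probability distribution $P$ on $\mathbb R^d$, $Pf$ denotes the integral of $f$ with respect to $P$. $P$ is called $M$-bounded if its support is included in the closed ball $\mathcal B(0,M)$. Contrast function: $\gamma(\mathbf c,x)=\min_{j}\|x-c_j\|^2$. Risk: $R(\mathbf c)=P\gamma(\mathbf c,\cdot)$. $\mathcal M$ is the set of optimal codebooks, i.e. minimizers of $R$ over $(\mathbb R^d)^k$; $\mathbf c^*$ denotes an element of $\mathcal M$, and $\ell(\mathbf c,\mathbf c^* )=R(\mathbf c)-R(\mathbf c^* )$; all these depend on $P$. Voronoi cells: $V_i(\mathbf c)=\{x:\ \forall j\ne i,\ \|x-c_i\|\le\|x-c_j\|\}$. $$B=\inf_{\mathbf c^*\in\mathcal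 M,\ i\ne j}\|c_i^*-c_j^*\|,\qquad p_{\min}=\inf_{\mathbf c^*\in\mathcal M,\ i=1,\dots,k}P(V_i(\mathbf c^* )).$$ For $\mathbf c^*\in\mathcal M$, $N_{\mathbf c^*}=\bigcup_{i\ne j}V_i(\mathbf c^* )\cap V_j(\mathbf c^* )$. For a set $A$, $\mathcal B(A,t)=\bigcup_{a\in A}\mathcal B(a,t)$ (union of closed balls of radius $t$). $p(t)=\sup_{\mathbf c^*\in\mathcal M}P(\mathcal B(N_{\mathbf c^*},t))$. Margin condition with radius $r_0>0$: (i) $P$ is $M$-bounded; (ii) for all $0\le t\le r_0$, $p(t)\le\frac{B\,p_{\min}}{128M^2}\,t$. Separation: let $\tilde{\mathcal M}$ be the set of local minimizers of $\mathbf c\mapsto P\gamma(\mathbf c,\cdot)$ on $(\mathbb R^d)^k$. For $\varepsilon>0$, $P$ is $\varepsilon$-separated if $\inf_{\mathbf c\in\tilde{\mathcal M}\setminus\mathcal M}\ell(\mathbf c,\mathbf c^* )=\varepsilon$. The class $\mathcal D(\varepsilon)$: let $m=2k/3$ and $\Delta=\frac{5M}{32m^{1/d}}$. $\mathcal D(\varepsilon)$ is the set of probability distributions $P$ on $\mathbb R^d$ that are $\varepsilon$-separated, have a continuous density, have a unique optimal codebook (up to permutation of its code points), and satisfy a margin condition with parameters $$B=\Delta,\qquad r_0=\frac{7\Delta}{16},\qquad p_{\min}\ge\frac3{4k}.$$ *)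

(* Defs.v *)
From HB Require Import structures.
From mathcomp Require Import all_boot all_order all_algebra.
From mathcomp Require Import all_classical all_reals all_analysis.

Set Implicit Arguments.
Unset Strict Implicit.
Unset Printing Implicit Defensive.
Import Order.TTheory GRing.Theory Num.Theory.
Import numFieldNormedType.Exports.

Local Open Scope classical_set_scope.
Local Open Scope ring_scope.
Local Open Scope ereal_scope.

(* The product topology on T^n; the library gives n.-tuple T the product
   sigma-algebra, so that d.-tuple R carries the usual topology of R^d and its
   Borel sigma-algebra. *)
HB.instance Definition _ (n : nat) (T : topologicalType) :=
  Topological.copy (n.-tuple T)
    (initial_topology (fun t : n.-tuple T =>
       (tnth t : prod_topology (fun _ : 'I_n => T)))).

Section tuple_cons.
Context (disp : measure_display) (T : measurableType disp).

Definition tuple_cons n (x : T * n.-tuple T) : n.+1.-tuple T :=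
  [the n.+1.-tuple T of x.1 :: x.2].

Lemma measurable_tuple_cons n :
  measurable_fun [set: T * n.-tuple T] (@tuple_cons n).
Proof. exact: measurable_cons. Qed.

HB.instance Definition _ n :=
  isMeasurableFun.Build _ _ _ _ (@tuple_cons n) (@measurable_tuple_cons n).

End tuple_cons.

Section cons_measure.
Context (disp : measure_display) (T : measurableType disp) (R : realType).
Variables (n : nat) (m1 : {sigma_finite_measure set T -> \bar R})
  (m2 : {sigma_finite_measure set (n.-tuple T) -> \bar R}).

Definition cons_measure : set (n.+1.-tuple T) -> \bar R :=
  pushforward (m1 \x m2) (@tuple_cons _ T n).

Let cons_measure0 : cons_measure set0 = 0.
Proof. exact: measure0. Qed.

Let cons_measure_ge0 A : 0 <= cons_measure A.
Proof. exact: measure_ge0. Qed.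

Let cons_measure_sigma_additive : semi_sigma_additive cons_measure.
Proof. exact: measure_semi_sigma_additive. Qed.

HB.instance Definition _ := isMeasure.Build _ _ _ cons_measure
  cons_measure0 cons_measure_ge0 cons_measure_sigma_additive.

Let cons_measure_sigma_finite : sigma_finite setT cons_measure.
Proof.
have /sigma_finiteP[F [TF ndF Foo]] := sigma_finiteT m1.
have /sigma_finiteP[G [TG ndG Goo]] := sigma_finiteT m2.
pose g (t : n.+1.-tuple T) := (thead t, [tuple of behead t]).
have mg : measurable_fun setT g.
  by apply/measurable_fun_pairP; split;
    [exact: measurable_tnth | exact: measurable_behead].
have gK (x : T * n.-tuple T) : g (tuple_cons x) = x.
  by case: x => a t; rewrite /g /tuple_cons theadE; congr pair; exact/val_inj.
exists (fun i => g @^-1` (F i `*` G i)).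
  rewrite -preimage_bigcup -[LHS](@preimage_setT _ _ g); congr preimage.
  rewrite -setXTT TF TG predeqE => -[x y]; split.
    move=> [/= [i _ Fix] [j _ Gjy]]; exists (maxn i j) => //; split.
      by move: x Fix; exact/subsetPset/ndF/leq_maxl.
    by move: y Gjy; exact/subsetPset/ndG/leq_maxr.
  by move=> [i _ []/= ? ?]; split; exists i.
move=> i; have [mF Fi] := Foo i; have [mG Gi] := Goo i; split.
  by rewrite -[X in measurable X]setTI; apply: mg => //; exact: measurableX.
rewrite /cons_measure /pushforward.
rewrite (_ : _ @^-1` (_ @^-1` _) = F i `*` G i).
  by rewrite product_measure1E// lte_mul_pinfty// ge0_fin_numE.
rewrite -comp_preimage (_ : g \o _ = id) ?preimage_id//.
by apply/funext => x; exact: gK.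
Qed.

HB.instance Definition _ := Measure_isSigmaFinite.Build _ _ _
  cons_measure cons_measure_sigma_finite.

End cons_measure.

(* The n-fold product measure. *)
Fixpoint tuple_measure (disp : measure_display) (T : measurableType disp)
    (R : realType) (mu : {sigma_finite_measure set T -> \bar R}) (n : nat) :
    {sigma_finite_measure set (n.-tuple T) -> \bar R} :=
  match n with
  | 0 => dirac [tuple]
  | n'.+1 => cons_measure mu (tuple_measure mu n')
  end.

Lemma tuple_measure_box (disp : measure_display) (T : measurableType disp)
    (R : realType) (mu : {sigma_finite_measure set T -> \bar R}) (n : nat)
    (A : 'I_n -> set T) : (forall i, measurable (A i)) ->
  tuple_measure mu n [set t | forall i, A i (tnth t i)]
  = \prod_(i < n) mu (A i).
Proof.
elim: n A => [|n IH] A mA.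
  rewrite big_ord0 /= (_ : [set _ | _] = setT) ?diracT//.
  by apply/seteqP; split=> // t _ [].
rewrite big_ord_recl -IH//= /cons_measure /pushforward.
rewrite (_ : _ @^-1` _ =
  A ord0 `*` [set t | forall i, A (lift ord0 i) (tnth t i)]).
  rewrite product_measure1E//.
  rewrite (_ : [set _ | _] = \big[setI/setT]_(i < n)
    ((fun t : n.-tuple T => tnth t i) @^-1` A (lift ord0 i))).
    apply: bigsetI_measurable => i _.
    by rewrite -[X in measurable X]setTI; exact: measurable_tnth.
  by apply/seteqP; split=> t; rewrite -bigcap_seq /=; [move=> H i _|move=> H i; apply: H; rewrite /= mem_index_enum].
apply/seteqP; split => -[a t] /=.
  move=> H; split; first exact: H ord0.
  by move=> i; have := H (lift ord0 i); rewrite tnthS.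
by move=> [H0 H] i; case: (unliftP ord0 i) => [j|] ->; rewrite ?tnthS.
Qed.

(* lebesgue_measure lives on measurableTypeR R, whose sigma-algebra is that of R
   under another measure_display; this is the same measure on R itself. *)
Section lebesgue_real.
Context (R : realType).

Definition lebesgue_real : set R -> \bar R := @lebesgue_measure R.

Let lebesgue_real0 : lebesgue_real set0 = 0.
Proof. exact: (measure0 (@lebesgue_measure R)). Qed.

Let lebesgue_real_ge0 A : 0 <= lebesgue_real A.
Proof. exact: (measure_ge0 (@lebesgue_measure R)). Qed.

Let lebesgue_real_sigma_additive : semi_sigma_additive lebesgue_real.
Proof. exact: (@measure_semi_sigma_additive _ _ _ (@lebesgue_measure R)). Qed.

HB.instance Definition _ := isMeasure.Build _ _ _ lebesgue_real
  lebesgue_real0 lebesgue_real_ge0 lebesgue_real_sigma_additive.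

Let lebesgue_real_sigma_finite : sigma_finite setT lebesgue_real.
Proof. exact: (sigma_finiteT (@lebesgue_measure R)). Qed.

HB.instance Definition _ := Measure_isSigmaFinite.Build _ _ _
  lebesgue_real lebesgue_real_sigma_finite.

End lebesgue_real.

Section quantization.
Context (R : realType) (d k : nat).
Implicit Types (P : probability (d.-tuple R) R) (x y : d.-tuple R).
Implicit Types (c : k.-tuple (d.-tuple R)) (A : set (d.-tuple R)).

Definition edist x y : R :=
  Num.sqrt (\sum_(i < d) (tnth x i - tnth y i) ^+ 2)%R.

Definition eball x (r : R) : set (d.-tuple R) := [set y | (edist x y <= r)%R].

Definition thickening A (t : R) : set (d.-tuple R) :=
  \bigcup_(a in A) eball a t.

Definition msupport P : set (d.-tuple R) :=
  [set x | forall r : R, (0 < r)%R -> 0 < P (eball x r)].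

Definition bounded_distribution P (M : R) :=
  msupport P `<=` eball [tuple 0%R | _ < d] M.

Definition lebesgue_Rd : {sigma_finite_measure set (d.-tuple R) -> \bar R} :=
  tuple_measure (@lebesgue_real R) d.

Definition has_continuous_density P :=
  exists f : d.-tuple R -> R, [/\ continuous f, (forall x, (0 <= f x)%R) &
    forall A, measurable A -> P A = \int[lebesgue_Rd]_(x in A) (f x)%:E].

(* The minimum is taken in \bar R, with +oo as neutral element. *)
Definition contrast c x : \bar R :=
  \big[mine/+oo]_(j < k) ((edist x (tnth c j)) ^+ 2)%:E.

Definition risk P c : \bar R := \int[P]_x contrast c x.

Definition optimal P : set (k.-tuple (d.-tuple R)) :=
  [set c | forall c', risk P c <= risk P c'].

Definition local_minimizer P : set (k.-tuple (d.-tuple R)) :=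
  [set c | \forall c' \near c, risk P c <= risk P c'].

Definition loss P c c' : \bar R := risk P c - risk P c'.

Definition voronoi c (i : 'I_k) : set (d.-tuple R) :=
  [set x | forall j, j != i -> (edist x (tnth c i) <= edist x (tnth c j))%R].

Definition voronoi_boundary c : set (d.-tuple R) :=
  [set x | exists i j, [/\ i != j, voronoi c i x & voronoi c j x]].

(* Infima and suprema are taken in \bar R, so that inf of the empty set is +oo. *)
Definition B_of P : \bar R :=
  ereal_inf [set b | exists c i j, [/\ optimal P c, i != j &
                       b = (edist (tnth c i) (tnth c j))%:E]].

Definition pmin_of P : \bar R :=
  ereal_inf [set q | exists c i, optimal P c /\ q = P (voronoi c i)].

Definition boundary_mass P (t : R) : \bar R :=
  ereal_sup [set P (thickening (voronoi_boundary c) t) | c in optimal P].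

Definition margin_condition P (M r0 : R) :=
  bounded_distribution P M /\
  forall t : R, (0 <= t <= r0)%R ->
    boundary_mass P t <= B_of P * pmin_of P * (t / (128 * M ^+ 2))%:E.

(* risk P c' is the same for every c' in optimal P. *)
Definition separated P (eps : R) :=
  exists2 c', optimal P c' &
    ereal_inf [set loss P c c' | c in local_minimizer P `\` optimal P]
    = eps%:E.

Definition unique_optimal P :=
  exists2 c, optimal P c & forall c', optimal P c' -> perm_eq c' c.

(* Delta = 5 M / (32 m^(1/d)) with m = 2 k / 3. *)
Definition Delta (M : R) : R :=
  (5 * M / (32 * (2 * k%:R / 3) `^ d%:R^-1))%R.

Definition class_D (M eps : R) : set (probability (d.-tuple R) R) :=
  [set P | [/\ separated P eps, has_continuous_density P, unique_optimal P,
               margin_condition P M (7 * Delta M / 16) &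
               B_of P = (Delta M)%:E /\ (3 / (4 * k%:R))%:E <= pmin_of P]].

(* The integral is over the canonical sample space: under P^n the n coordinates
   are i.i.d. with distribution P. *)
Definition expected_loss P n (chat : n.-tuple (d.-tuple R) -> k.-tuple (d.-tuple R))
    c' : \bar R :=
  \int[tuple_measure P n]_X loss P (chat X) c'.

End quantization.

(* Main.v *)
Require Import Defs.
From HB Require Import structures.
From mathcomp Require Import all_boot all_order all_algebra.
From mathcomp Require Import all_classical all_reals all_analysis.
From mathcomp Require Import measurable_realfun ring lra zify.
Import Order.TTheory GRing.Theory Num.Theory.
Import numFieldNormedType.Exports.
Import Defs.

(** The supremum is bounded below by exhibiting finitely many distributions of
    the class that are hard to tell apart.  Write k = 3j, so that m = 2j, let
    Delta be the prescribed distance, and fix m points z_i of the ball of radius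
    25M/32 whose mutual distances are at least 5 Delta ([packing_ball]).  Around
    each z_i stands a pair of small blobs, centred at distance Delta/2 of z_i on
    both sides in the first direction and supported by balls of radius
    Delta/100; their density is a product of Epanechnikov kernels, so that it is
    continuous and its moments are explicit.  The pairs are matched two by two
    into j couples.  In each couple, one pair has mass (1 + delta)/m and is
    heavy, the other has mass (1 - delta)/m and is light, with
    delta = sqrt (m/n) / 2 <= 1/3; a sign vector th, with one sign per couple,
    tells which is which.

    Optimal codebooks.  Serving a pair by two codes rather than by its midpoint
    saves Delta^2/4 per unit of mass.  Put on each code the price
    Delta^2/(4m), which is what the second code of a pair of mass 1/m would save:
    then two codes are worth their price exactly on the heavy pairs, and a misfit,
    that is a heavy pair with fewer than two codes or a light one with at least
    two, costs at least delta * price ([excess_ge]).  As k codes are just what the optimal allocation of two codes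
    to each heavy pair and one to each light pair requires, it follows that the
    risk exceeds its minimum by delta * price per misfit ([prisk_ge]), and that
    the optimal codebook is unique up to order ([prisk_ropt_codes]).

    Membership in the class.  The codes serving the blobs do so with room to
    spare, so that the density vanishes within 7 Delta/16 of the Voronoi
    boundary, which makes the margin condition hold ([model_boundary]).  The
    codebook optimal for th with one sign flipped is a local minimizer whose risk
    is above the minimum by 2 * delta * price.  Below this level, the codes are
    allocated as in an optimal codebook; the risk is then bounded above by a
    convex quadratic function that touches it at the codebook and whose minimum
    is the minimal risk, so that moving towards the minimizer of this function
    decreases the risk strictly ([prisk_descent]) and only optimal codebooks are
    local minimizers.  Hence the separation is exactly 2 * delta * price, which
    is c_1 / sqrt n ([model_separated], [separationE]).

    Statistics.  Two sign vectors that differ in one couple give distributions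
    with affinity 1 - delta^2/j, and n delta^2 <= j/2 makes every test between
    them err with total probability at least 1/8 ([two_point_testing]).  A misfit
    of a pair for th is a fit of it for the flipped vector, so that on average
    over th each of the 2j pairs is a misfit with probability at least 1/16
    ([exists_large_mass]).  For some th, the expected loss is therefore at least
    delta * price * j/8 = delta * Delta^2 / 64, which is of the announced order
    ([rateE]). *)

Set Implicit Arguments.
Unset Strict Implicit.
Unset Printing Implicit Defensive.

Local Open Scope classical_set_scope.
Local Open Scope ring_scope.

(** * Euclidean distance on tuples *)

Section euclidean.
Context (R : realType) (d : nat).
Implicit Types x y z : d.-tuple R.

Lemma edist_ge0 x y : 0 <= edist x y.
Proof. exact: sqrtr_ge0. Qed.

Lemma edist_sqr x y :
  edist x y ^+ 2 = \sum_(s < d) (tnth x s - tnth y s) ^+ 2.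
Proof. by rewrite sqr_sqrtr// sumr_ge0// => s _; exact: sqr_ge0. Qed.

Lemma edistC x y : edist x y = edist y x.
Proof.
by rewrite /edist; congr Num.sqrt; apply: eq_bigr => s _; ring.
Qed.

Lemma edistxx x : edist x x = 0.
Proof. by rewrite /edist big1 ?sqrtr0// => s _; rewrite subrr expr0n. Qed.

Lemma edist_le0 x y : edist x y <= 0 -> x = y.
Proof.
move=> xy0; have xy : edist x y ^+ 2 = 0.
  by have /eqP -> : edist x y == 0; [rewrite eq_le xy0 edist_ge0|rewrite expr0n].
move: xy; rewrite edist_sqr => /eqP.
rewrite psumr_eq0 => [/allP h|s _]; last exact: sqr_ge0.
apply: eq_from_tnth => s; have := h s (mem_index_enum s).
by rewrite /= sqrf_eq0 subr_eq0 => /eqP.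
Qed.

Lemma sum_cauchy_schwarz (u v : 'I_d -> R) :
  (\sum_s u s * v s) ^+ 2 <= (\sum_s u s ^+ 2) * (\sum_s v s ^+ 2).
Proof.
set A := \sum_s u s ^+ 2; set B := \sum_s v s ^+ 2; set C := \sum_s u s * v s.
have B0 : 0 <= B by apply: sumr_ge0 => s _; exact: sqr_ge0.
have [Bz|Bn] := eqVneq B 0.
  have vz s : v s = 0.
    move/eqP: Bz; rewrite psumr_eq0 => [/allP h|t _]; last exact: sqr_ge0.
    by have := h s (mem_index_enum s); rewrite /= sqrf_eq0 => /eqP.
  by rewrite Bz mulr0 /C big1 ?expr0n// => s _; rewrite vz mulr0.
have Bp : 0 < B by rewrite lt_neqAle eq_sym Bn.
have : 0 <= \sum_s (B * u s - C * v s) ^+ 2 by apply: sumr_ge0 => s _; exact: sqr_ge0.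
rewrite (_ : \sum_s _ = B * (A * B - C ^+ 2)) ?pmulr_rge0 ?subr_ge0//.
rewrite (eq_bigr (fun s => B ^+ 2 * u s ^+ 2 - 2 * B * C * (u s * v s)
  + C ^+ 2 * v s ^+ 2)); last by move=> s _; ring.
by rewrite big_split sumrB -!mulr_sumr -/A -/B -/C /=; ring.
Qed.

Lemma edist_triangle y x z : edist x z <= edist x y + edist y z.
Proof.
rewrite -(@ler_pXn2r _ 2)// ?nnegrE ?addr_ge0 ?edist_ge0//.
rewrite sqrrD !edist_sqr.
pose u s := tnth x s - tnth y s; pose v s := tnth y s - tnth z s.
have -> : \sum_(s < d) (tnth x s - tnth z s) ^+ 2 =
  \sum_s u s ^+ 2 + (\sum_s u s * v s) *+ 2 + \sum_s v s ^+ 2.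
  rewrite -mulr_natl mulr_sumr -!big_split/=; apply: eq_bigr => s _.
  by rewrite /u /v; ring.
rewrite lerD2r lerD2l lerMn2r/= /edist -/u -sqrtrM; last first.
  by apply: sumr_ge0 => s _; exact: sqr_ge0.
rewrite (le_trans (ler_norm _))// -sqrtr_sqr ler_wsqrtr//.
exact: sum_cauchy_schwarz.
Qed.

Lemma coord_le_edist x y s : `|tnth x s - tnth y s| <= edist x y.
Proof.
rewrite -sqrtr_sqr ler_wsqrtr// (bigD1 s)//= lerDl.
by apply: sumr_ge0 => t _; exact: sqr_ge0.
Qed.

Lemma edist_le_coord (e : R) x y : 0 <= e ->
  (forall s, `|tnth x s - tnth y s| <= e) -> edist x y <= d%:R * e.
Proof.
move=> e0 xye; rewrite -(@ler_pXn2r _ 2)// ?nnegrE ?edist_ge0 ?mulr_ge0//.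
rewrite edist_sqr (@le_trans _ _ (\sum_(s < d) e ^+ 2))//.
  by apply: ler_sum => s _; rewrite -real_normK ?num_real// ler_pXn2r// nnegrE.
rewrite sumr_const card_ord -(mulr_natl (e ^+ 2)) exprMn.
by apply: ler_pM; rewrite ?sqr_ge0// -natrX ler_nat; nia.
Qed.

Definition lincomb (u : R) x (v : R) y : d.-tuple R :=
  [tuple u * tnth x s + v * tnth y s | s < d].

Lemma edist_homothety (t : R) x y x' y' :
  (forall s, tnth x s - tnth y s = t * (tnth x' s - tnth y' s)) ->
  edist x y = `|t| * edist x' y'.
Proof.
move=> xy; rewrite -sqrtr_sqr -sqrtrM ?sqr_ge0// /edist mulr_sumr.
by congr Num.sqrt; apply: eq_bigr => s _; rewrite xy exprMn.
Qed.

End euclidean.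

Lemma expr_small (R : realType) (q e : R) : 0 <= q < 1 -> 0 < e ->
  exists j, q ^+ j < e.
Proof.
move=> /andP[q0 q1] e0.
have /cvgrPdist_lt /(_ e e0) : (fun j => q ^+ j) @ \oo --> (0 : R).
  by apply: cvg_expr; rewrite ger0_norm.
move=> [j _ /(_ j (leqnn j))] /=; rewrite sub0r normrN ger0_norm ?exprn_ge0//.
by exists j.
Qed.

Definition origin (R : realType) (d : nat) : d.-tuple R := [tuple 0 | _ < d].

(** * Packing points in a ball *)

Section packing.
Context (R : realType) (d : nat).
Hypothesis d_gt0 : (0 < d)%N.
Implicit Types (x y : d.-tuple R) (s L : seq (d.-tuple R)).

Local Notation o := (origin R d).

Lemma cover_iter s (r th : R) : 0 < th ->
  (forall x, edist o x <= r -> exists2 p, p \in s & edist p x <= th * r) ->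
  forall j, exists2 L, size L = (size s ^ j)%N &
    forall x, edist o x <= r -> exists2 p, p \in L & edist p x <= th ^+ j * r.
Proof.
move=> th0 cov; elim=> [|j [L sL covL]].
  by exists [:: o] => // x xr; exists o; rewrite ?mem_seq1// expr0 mul1r.
exists [seq lincomb 1 p (th ^+ j) q | p <- L, q <- s].
  by rewrite size_allpairs sL expnSr.
move=> x /covL[p pL px]; have tj0 : 0 < th ^+ j by rewrite exprn_gt0.
pose x' := lincomb (th ^- j) x (- th ^- j) p.
have [|q qs qx'] := cov x'.
  rewrite (@edist_homothety _ _ (th ^- j) _ _ p x); last first.
    by move=> s0; rewrite !tnth_mktuple; ring.
  by rewrite gtr0_norm ?invr_gt0// mulrC ler_pdivrMr// mulrC.
exists (lincomb 1 p (th ^+ j) q); first by apply/allpairsP; exists (p, q).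
rewrite (@edist_homothety _ _ (th ^+ j) _ _ q x'); last first.
  by move=> s0; rewrite !tnth_mktuple; field; rewrite gt_eqF.
by rewrite gtr0_norm// exprSr -mulrA ler_pM2l.
Qed.

(** A ball of radius e contains at most one point of a grid of mesh h > 2 e. *)
Lemma grid_card_le L (h r e : R) (Q : nat) : 0 <= h -> 2 * e < h ->
  d%:R * (h * Q%:R) <= r ->
  (forall x, edist o x <= r -> exists2 p, p \in L & edist p x <= e) ->
  (Q.+1 ^ d <= size L)%N.
Proof.
move=> h0 eh dQ cov.
pose g (v : {ffun 'I_d -> 'I_Q.+1}) : d.-tuple R := [tuple h * (v s)%:R | s < d].
have gr v : edist o (g v) <= r.
  apply: le_trans dQ; apply: edist_le_coord; first by rewrite mulr_ge0.
  move=> s; rewrite !tnth_mktuple sub0r normrN ger0_norm ?mulr_ge0//.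
  by apply: ler_wpM2l => //; rewrite ler_nat -ltnS.
have /choice[f fP] : forall v, exists p, p \in L /\ edist p (g v) <= e.
  by move=> v; have [p pL pe] := cov _ (gr v); exists p.
have finj : injective f.
  move=> v v' vv'; apply/ffunP => s; apply/val_inj/eqP.
  have : edist (g v) (g v') < h.
    apply: le_lt_trans eh; rewrite mulr2n mulrDl mul1r.
    apply: le_trans (edist_triangle (f v) _ _) _; apply: lerD.
      by rewrite edistC; have [] := fP v.
    by rewrite vv'; have [] := fP v'.
  move=> /(le_lt_trans (coord_le_edist _ _ s)); rewrite !tnth_mktuple -mulrBr.
  rewrite normrM (ger0_norm h0) -[ltRHS]mulr1 => hlt.
  have {hlt} : `|(v s)%:R - (v' s)%:R| < 1 :> R.
    rewrite ltNge; apply/negP => ge1; move: hlt; rewrite ltNge => /negP; apply.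
    exact: ler_wpM2l.
  rewrite ltr_norml => /andP[].
  move=> a b; rewrite eqn_leq; apply/andP.
  by split; rewrite -ltnS -(ltr_nat R) -natr1; lra.
have := @uniq_leq_size _ (map f (enum {ffun 'I_d -> 'I_Q.+1})) L.
rewrite map_inj_uniq// enum_uniq size_map -cardE card_ffun !card_ord; apply => //.
by move=> p /mapP[v _ ->]; have [] := fP v.
Qed.

(** Iterating a covering of a ball by N balls of relative radius th covers it by
    N^j balls of relative radius th^j.  Distinct points of a grid of a slightly
    larger mesh lie in distinct such balls, and there are about th^(-jd) grid
    points, so that N th^d >= 1.  This stands in for a comparison of volumes. *)
Lemma cover_card s (r th : R) : 0 < r -> 0 < th ->
  (forall x, edist o x <= r -> exists2 p, p \in s & edist p x <= th * r) ->
  1 <= (size s)%:R * th ^+ d.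
Proof.
move=> r0 th0 cov; rewrite leNgt; apply/negP => lt1.
have dR : 0 < d%:R :> R by rewrite ltr0n.
have [||j] := @expr_small R ((size s)%:R * th ^+ d) (((3 * d%:R) ^+ d)^-1).
- by rewrite lt1 mulr_ge0// exprn_ge0// ltW.
- by rewrite invr_gt0 exprn_gt0// mulr_gt0.
apply/negP; rewrite -leNgt.
have [L sL covL] := cover_iter th0 cov j.
have tj0 : 0 < th ^+ j by rewrite exprn_gt0.
(* Any factor above 2 makes the mesh exceed the diameter of the small balls. *)
pose h := 3 * (th ^+ j * r).
have h0 : 0 < h by rewrite !mulr_gt0.
pose Q := Num.truncn (r / (d%:R * h)).
have /andP[Q1 Q2] : (Q%:R <= r / (d%:R * h) < Q.+1%:R).
  by apply: truncn_itv; rewrite divr_ge0 ?mulr_ge0 ?ltW.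
have := @grid_card_le L h r (th ^+ j * r) Q (ltW h0).
move=> /(_ _ _ covL); rewrite /h ltr_pM2r ?mulr_gt0// ltr_nat => /(_ isT).
rewrite -/h; have -> : d%:R * (h * Q%:R) <= r.
  by rewrite mulrA mulrC -ler_pdivlMr ?mulr_gt0.
move=> /(_ isT); rewrite sL -(ler_nat R) natrX natrX => QN.
rewrite -[leLHS]mul1r ler_pdivrMr ?exprn_gt0 ?mulr_gt0//.
have ge1 : 1 <= Q.+1%:R * (3 * d%:R) * th ^+ j.
  move: Q2; rewrite ltr_pdivrMr ?mulr_gt0// /h => /ltW.
  by rewrite -(ler_pM2r r0) mul1r; congr (_ <= _); ring.
apply: le_trans (exprn_ege1 d ge1) _.
rewrite !exprMn -[(th ^+ j) ^+ d]exprM mulnC exprM mulrAC.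
apply: ler_wpM2r; first by rewrite mulr_ge0 ?exprn_ge0.
by apply: ler_wpM2r => //; rewrite !exprn_ge0// ltW.
Qed.

(** A maximal D-separated subset of the ball covers it by balls of radius D, so
    that it has at least (r/D)^d points. *)
Lemma packing_ball (r D : R) (m : nat) : 0 < r -> 0 < D ->
  m%:R * D ^+ d <= r ^+ d ->
  exists z : 'I_m -> d.-tuple R, (forall i, edist o (z i) <= r) /\
    (forall i i', i != i' -> D <= edist (z i) (z i')).
Proof.
move=> r0 D0 mD.
have : forall N, (N <= m)%N -> exists s, [/\ size s = N,
    (forall x, x \in s -> edist o x <= r) & pairwise (fun x y => D <= edist x y) s].
  elim=> [|N IH] Nm; first by exists [::].
  have [s [sN sr sD]] := IH (ltnW Nm).
  have [[x xr xs]|cov] := pselect (exists2 x, edist o x <= r &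
      forall p, p \in s -> D <= edist x p).
    exists (x :: s); split => /=; first by rewrite sN.
      by move=> y; rewrite in_cons => /predU1P[->|/sr].
    by rewrite sD andbT; apply/allP.
  have : 1 <= (size s)%:R * (D / r) ^+ d.
    apply: (cover_card r0 (divr_gt0 D0 r0)) => x xr; rewrite divfK ?gt_eqF//.
    apply: contrapT => nx; apply: cov; exists x => // p ps; rewrite leNgt.
    by apply/negP => px; apply: nx; exists p; rewrite // edistC ltW.
  rewrite expr_div_n mulrA ler_pdivlMr ?exprn_gt0// mul1r => rN.
  move: (le_trans mD rN); rewrite ler_pM2r ?exprn_gt0// ler_nat sN.
  by rewrite leqNgt Nm.
move=> /(_ m (leqnn m))[s [sm sr /(pairwiseP o) sD]].
exists (fun i => nth o s i); split => [i|i i'].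
  by apply: sr; rewrite mem_nth// sm.
rewrite -val_eqE/= neq_ltn => /orP[] ii'.
  by apply: sD; rewrite ?inE ?sm.
by rewrite edistC; apply: sD; rewrite ?inE ?sm.
Qed.

End packing.

(** * Integrals of products and compactly supported densities *)

Lemma integral_tuple_prod (disp : measure_display) (T : measurableType disp)
    (R : realType) (mu : {sigma_finite_measure set T -> \bar R}) (n : nat)
    (G : 'I_n -> T -> R) :
  (forall s, measurable_fun setT (G s)) -> (forall s x, 0 <= G s x) ->
  (\int[tuple_measure mu n]_x (\prod_(s < n) G s (tnth x s))%:E =
   \prod_(s < n) \int[mu]_x (G s x)%:E)%E.
Proof.
elim: n G => [|n IH] G mG G0.
  rewrite big_ord0.
  under eq_integral do rewrite big_ord0.
  rewrite integral_cst//=.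
  by rewrite diracT mul1e.
have mP m (H : 'I_m -> T -> R) : (forall s, measurable_fun setT (H s)) ->
    measurable_fun setT (EFin \o fun x : m.-tuple T => \prod_(s < m) H s (tnth x s)).
  move=> mH; apply/measurable_EFinP; apply: measurable_prod => s _.
  by apply: (measurableT_comp (mH s)); exact: measurable_tnth.
pose f (x : n.+1.-tuple T) := (\prod_(s < n.+1) G s (tnth x s))%:E.
rewrite [LHS](_ : _ = \int[pushforward (mu \x tuple_measure mu n) (@tuple_cons _ T n)]_x f x)%E//.
rewrite ge0_integral_pushforward//=; last 2 first.
- exact: mP.
- by move=> y _; rewrite lee_fin prodr_ge0.
rewrite preimage_setT fubini_tonelli1/=; last 2 first.
- apply: (measurableT_comp (mP _ _ _)) => //; exact: measurable_tuple_cons.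
- by move=> y; rewrite lee_fin prodr_ge0.
rewrite /fubini_F/= big_ord_recl.
have e (x : T) (y : n.-tuple T) : f (tuple_cons (x, y)) =
    ((G ord0 x)%:E * (\prod_(s < n) G (lift ord0 s) (tnth y s))%:E)%E.
  rewrite /f big_ord_recl EFinM; congr (_ * (_)%:E)%E.
  by apply: eq_bigr => s _; rewrite tnthS.
have ei (x : T) : (\int[tuple_measure mu n]_y f (tuple_cons (x, y)) =
    (G ord0 x)%:E * \prod_(s < n) \int[mu]_x (G (lift ord0 s) x)%:E)%E.
  under eq_integral do rewrite e.
  rewrite ge0_integralZl; [by rewrite (IH (fun s => G (lift ord0 s)))|by []| | |by rewrite lee_fin].
    exact: (mP n (fun s => G (lift ord0 s))).
  by move=> y _; rewrite lee_fin prodr_ge0.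
under eq_integral do rewrite ei.
rewrite ge0_integralZr//.
- exact/measurable_EFinP.
- by move=> x _; rewrite lee_fin.
- by apply: prode_ge0 => s _; apply: integral_ge0 => x _; rewrite lee_fin.
Qed.

Section epanechnikov.
Context (R : realType).
Implicit Types (a h c x : R) (p Q : {poly R}).

(** The Epanechnikov kernel of centre a and half-width h is continuous and is a
    polynomial on its support, so that its moments follow from the fundamental
    theorem of calculus. *)
Definition epan h a x : R := 3 / (4 * h ^+ 3) * Num.max 0 (h ^+ 2 - (x - a) ^+ 2).

Lemma epan_ge0 h a x : 0 < h -> 0 <= epan h a x.
Proof.
move=> h0; apply: mulr_ge0; last by rewrite le_max lexx.
by rewrite divr_ge0// mulr_ge0// exprn_ge0// ltW.
Qed.

Lemma epan_eq0 h a x : 0 < h -> h <= `|x - a| -> epan h a x = 0.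
Proof.
move=> h0 hx; rewrite /epan max_l ?mulr0// subr_le0 -[leRHS]real_normK ?num_real//.
by rewrite ler_pXn2r// nnegrE ltW.
Qed.

Lemma epanE h a x : 0 < h -> x \in `[a - h, a + h] ->
  epan h a x = 3 / (4 * h ^+ 3) * (h ^+ 2 - (x - a) ^+ 2).
Proof.
move=> h0; rewrite in_itv/= => /andP[x1 x2]; rewrite /epan max_r// subr_ge0.
by rewrite -real_normK ?num_real// ler_pXn2r ?nnegrE ?(ltW h0)// ler_norml; lra.
Qed.

Lemma continuous_epan h a : continuous (epan h a).
Proof.
pose p : {poly R} := (h ^+ 2)%:P - ('X - a%:P) ^+ 2.
have -> : epan h a = fun x => 3 / (4 * h ^+ 3) * Num.max 0 p.[x].
  by apply/funext => x; rewrite /epan /p !hornerE.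
move=> x; apply: cvgMr.
apply: (@continuous_max _ _ (cst 0) (horner p)); first exact: cvg_cst.
exact: continuous_horner.
Qed.

Lemma measurable_epan h a : measurable_fun setT (epan h a).
Proof. by apply: continuous_measurable_fun; exact: continuous_epan. Qed.

(** The two integrals are for one measure under two names of the Borel
    sigma-algebra of the line. *)
Lemma integral_lebesgue_real (f : R -> \bar R) : measurable_fun setT f ->
  (forall x, (0 <= f x)%E) ->
  (\int[@lebesgue_real R]_x f x = \int[@lebesgue_measure R]_x f x)%E.
Proof.
move=> mf f0.
pose i (x : measurableTypeR R) : R := x.
have mi : measurable_fun setT i by move=> _ Y mY; rewrite setTI.
transitivity (\int[pushforward (@lebesgue_measure R) i]_x f x)%E.
  by apply: eq_measure_integral => A mA _.
by rewrite ge0_integral_pushforward.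
Qed.

(** The primitive Q is that of the polynomial (h^2 - (X - a)^2) p, which up to the
    normalizing constant agrees with the integrand on its support. *)
Lemma integral_epan_horner h a p Q : 0 < h -> (forall x, 0 <= p.[x]) ->
  Q^`() = (h ^+ 2)%:P * p - ('X - a%:P) ^+ 2 * p ->
  (\int[@lebesgue_real R]_x (epan h a x * p.[x])%:E =
   (3 / (4 * h ^+ 3) * (Q.[a + h] - Q.[a - h]))%:E)%E.
Proof.
move=> h0 p0 dQ.
pose q := (3 / (4 * h ^+ 3))%:P * Q.
have dq : q^`() = (3 / (4 * h ^+ 3))%:P * ((h ^+ 2)%:P * p - ('X - a%:P) ^+ 2 * p).
  by rewrite /q derivM derivC mul0r add0r dQ.
have ab : a - h < a + h by lra.
transitivity (\int[@lebesgue_measure R]_(x in `[(a - h)%R, (a + h)%R]) (q^`()).[x]%:E)%E.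
  rewrite integral_lebesgue_real; last 2 first.
  - apply/measurable_EFinP/measurable_funM; first exact: measurable_epan.
    by apply: continuous_measurable_fun; apply: continuous_horner.
  - by move=> x; rewrite lee_fin mulr_ge0// epan_ge0.
  rewrite [RHS]integral_mkcond; apply: eq_integral => x _.
  rewrite patchE; case: ifPn => [|/negP]; rewrite inE/= => xI.
    rewrite (epanE h0 xI) dq !hornerE; congr (_%:E); ring.
  rewrite epan_eq0 ?mul0r// leNgt; apply/negP => hx; apply: xI.
  by move: hx; rewrite in_itv/= ltr_norml; lra.
rewrite (@continuous_FTC2 _ _ (horner q))//.
- by rewrite -EFinB /q !hornerE -mulrBr.
- exact/continuous_subspaceT/continuous_horner.
- split.
  + by move=> x _; exact: derivable_horner.
  + exact/cvg_at_right_filter/continuous_horner.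
  + exact/cvg_at_left_filter/continuous_horner.
- by move=> x _; rewrite -derivE.
Qed.

Lemma integral_epan h a : 0 < h ->
  (\int[@lebesgue_real R]_x (epan h a x)%:E = 1)%E.
Proof.
move=> h0.
transitivity (\int[@lebesgue_real R]_x (epan h a x * (1%:P : {poly R}).[x])%:E)%E.
  by apply: eq_integral => x _; rewrite hornerC mulr1.
pose U := 'X - a%:P; have dU : U^`() = 1 by rewrite /U derivB derivX derivC subr0.
rewrite (@integral_epan_horner _ _ _ ((h ^+ 2)%:P * U - 3^-1%:P * U ^+ 3))//.
  congr (_%:E); rewrite /U !hornerE/=; field; by rewrite gt_eqF.
  by move=> x; rewrite hornerC.
have k3 : (3^-1)%:P * 3 = 1 :> {poly R} by rewrite -polyC_natr -polyCM mulVf.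
rewrite -/U derivB !derivM !derivC !dU /= polyC1.
set k := (3^-1)%:P in k3 *.
transitivity ((h ^+ 2)%:P - k * 3 * U ^+ 2); [ring|by rewrite k3; ring].
Qed.

Lemma integral_epan_sqr h a c : 0 < h ->
  (\int[@lebesgue_real R]_x (epan h a x * (x - c) ^+ 2)%:E =
   (h ^+ 2 / 5 + (a - c) ^+ 2)%:E)%E.
Proof.
move=> h0; pose p := ('X - c%:P) ^+ 2.
transitivity (\int[@lebesgue_real R]_x (epan h a x * p.[x])%:E)%E.
  by apply: eq_integral => x _; rewrite /p !hornerE.
pose U := 'X - a%:P; have dU : U^`() = 1 by rewrite /U derivB derivX derivC subr0.
pose e := a - c; pose H := (h ^+ 2)%:P; pose E := e%:P.
pose k (n : nat) : {poly R} := (n%:R^-1)%:P.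
rewrite (@integral_epan_horner _ _ _ (H * (k 3 * U ^+ 3 + E * U ^+ 2 + E ^+ 2 * U)
   - (k 5 * U ^+ 5 + k 2 * E * U ^+ 4 + k 3 * E ^+ 2 * U ^+ 3)))//.
- congr (_%:E); rewrite /U /H /E /k /e !hornerE/=; field; by rewrite gt_eqF.
- by move=> x; rewrite /p !hornerE sqr_ge0.
have kE n : (0 < n)%N -> k n * n%:R = 1.
  by move=> n0; rewrite /k -polyC_natr -polyCM mulVf// pnatr_eq0 -lt0n.
rewrite -/U -/H /p (_ : 'X - c%:P = U + E); last by rewrite /E /e polyCB addrA subrK.
rewrite derivB derivM !derivD !derivM !derivC !dU /=.
transitivity (H * (k 3 * 3 * U ^+ 2 + 2 * E * U + E ^+ 2)
   - (k 5 * 5 * U ^+ 4 + k 2 * 2 * (2 * E * U ^+ 3) + k 3 * 3 * E ^+ 2 * U ^+ 2)); first ring.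
by rewrite !kE//; ring.
Qed.

End epanechnikov.

(** * Smooth blobs in Euclidean space *)

Section blob.
Context (R : realType) (d : nat).
Implicit Types (h : R) (a c x : d.-tuple R).

Definition blob h a x : R := \prod_(s < d) epan h (tnth a s) (tnth x s).

Lemma blob_ge0 h a x : 0 < h -> 0 <= blob h a x.
Proof. by move=> h0; apply: prodr_ge0 => s _; exact: epan_ge0. Qed.

Lemma blob_eq0 h a x : 0 < h -> d%:R * h < edist x a -> blob h a x = 0.
Proof.
move=> h0; apply: contraTeq => /prodf_neq0 nz; rewrite -leNgt.
apply: (edist_le_coord (ltW h0)) => s; rewrite leNgt; apply/negP => hs.
by have := nz s isT; rewrite epan_eq0 ?eqxx// ltW.
Qed.

Lemma tuple_tnth_continuous (T : topologicalType) n (i : 'I_n) :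
  continuous (fun t : n.-tuple T => tnth t i).
Proof.
move=> t; apply: (@continuous_comp _ _ _
  (fun t : n.-tuple T => (tnth t : prod_topology (fun _ : 'I_n => T)))
  (fun u : prod_topology (fun _ : 'I_n => T) => u i)).
  exact: initial_continuous.
exact: proj_continuous.
Qed.

Lemma continuous_blob h a : continuous (blob h a).
Proof.
rewrite /blob => x; elim: (index_enum _) => [|s r IH].
  under eq_fun do rewrite big_nil.
  exact: cst_continuous.
under eq_fun do rewrite big_cons.
apply: (@continuousM R _ (fun y : d.-tuple R => epan h (tnth a s) (tnth y s))
  (fun y : d.-tuple R => \prod_(t <- r) epan h (tnth a t) (tnth y t))) => //.
apply: (@continuous_comp _ _ _ (fun y : d.-tuple R => tnth y s)).
  exact: tuple_tnth_continuous.
exact: continuous_epan.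
Qed.

Lemma measurable_blob h a : measurable_fun setT (blob h a).
Proof.
apply: measurable_prod => s _; apply: measurableT_comp; last exact: measurable_tnth.
exact: measurable_epan.
Qed.

Lemma integral_blob h a : 0 < h ->
  (\int[@lebesgue_Rd R d]_x (blob h a x)%:E = 1)%E.
Proof.
move=> h0; rewrite (integral_tuple_prod _ (G := fun s => epan h (tnth a s))).
- by under eq_bigr do rewrite integral_epan//; rewrite big1.
- by move=> s; exact: measurable_epan.
- by move=> s x; exact: epan_ge0.
Qed.

Lemma measurable_coord_sqr c (s : 'I_d) :
  measurable_fun setT (fun x : d.-tuple R => (tnth x s - tnth c s) ^+ 2).
Proof.
apply: (measurable_funX 2); apply: measurable_funB => //; exact: measurable_tnth.
Qed.

(** The coordinates are independent under the blob, and each contributes its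
    variance h^2/5 and its squared bias. *)
Lemma integral_blob_sqr h a c : 0 < h ->
  (\int[@lebesgue_Rd R d]_x (blob h a x * edist x c ^+ 2)%:E =
   (d%:R * (h ^+ 2 / 5) + edist a c ^+ 2)%:E)%E.
Proof.
move=> h0; under eq_integral do rewrite edist_sqr mulr_sumr -sumEFin.
rewrite ge0_integral_sum//; last 2 first.
- move=> s; apply/measurable_EFinP/measurable_funM; first exact: measurable_blob.
  exact: measurable_coord_sqr.
- by move=> s x _; rewrite lee_fin mulr_ge0 ?sqr_ge0 ?blob_ge0.
have one (s : 'I_d) : (\int[@lebesgue_Rd R d]_x (blob h a x * (tnth x s - tnth c s) ^+ 2)%:E
    = (h ^+ 2 / 5 + (tnth a s - tnth c s) ^+ 2)%:E)%E.
  pose G (t : 'I_d) y := epan h (tnth a t) y * (if t == s then (y - tnth c s) ^+ 2 else 1).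
  transitivity (\int[@lebesgue_Rd R d]_x (\prod_(t < d) G t (tnth x t))%:E)%E.
    apply: eq_integral => x _; congr (_%:E); rewrite /G big_split/= -/(blob h a x).
    by congr (_ * _); rewrite -big_mkcond big_pred1_eq.
  rewrite (integral_tuple_prod _ (G := G)).
  - rewrite (bigD1 s)//= [X in (_ * X)%E]big1 ?mule1 /G ?eqxx ?integral_epan_sqr//.
    move=> t /negbTE ->; under eq_integral do rewrite mulr1.
    exact: integral_epan.
  - rewrite /G => t; apply: measurable_funM; first exact: measurable_epan.
    by case: (t == s) => //; apply: (measurable_funX 2); apply: measurable_funB.
  - by move=> t y; rewrite mulr_ge0 ?epan_ge0//; case: ifP => // _; exact: sqr_ge0.
rewrite (eq_bigr _ (fun s _ => one s)) sumEFin big_split/= sumr_const card_ord.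
by rewrite mulr_natl edist_sqr.
Qed.

End blob.

(** * Probabilities given by a density *)

Section density.
Context (disp : measure_display) (T : measurableType disp) (R : realType).
Variables (mu : {measure set T -> \bar R}) (f : T -> R).
Hypotheses (mf : measurable_fun setT f) (f0 : forall x, 0 <= f x)
  (f1 : (\int[mu]_x (f x)%:E = 1)%E).

Definition density_prob of measurable_fun setT f & (forall x, 0 <= f x) &
  (\int[mu]_x (f x)%:E = 1)%E := fun A : set T => (\int[mu]_(x in A) (f x)%:E)%E.

Local Notation P := (density_prob mf f0 f1).

Let P0 : P set0 = 0%E. Proof. exact: integral_set0. Qed.

Let P_ge0 A : (0 <= P A)%E.
Proof. by apply: integral_ge0 => x _; rewrite lee_fin. Qed.

Let P_sigma_additive : semi_sigma_additive P.
Proof.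
apply: semi_sigma_additive_nng_induced => [|x]; last by rewrite lee_fin.
exact/measurable_EFinP.
Qed.

HB.instance Definition _ := isMeasure.Build _ _ _ P P0 P_ge0 P_sigma_additive.

Let P_setT : P setT = 1%E. Proof. exact: f1. Qed.

HB.instance Definition _ := Measure_isProbability.Build _ _ _ P P_setT.

Import HBNNSimple.

Lemma integral_density_prob (g : T -> \bar R) : measurable_fun setT g ->
  (forall x, (0 <= g x)%E) ->
  (\int[P]_x g x = \int[mu]_x (g x * (f x)%:E))%E.
Proof.
move=> mg g0.
pose h := nnsfun_approx measurableT mg.
have hg x : g x = limn (fun n => (h n x)%:E).
  by apply/esym/cvg_lim => //; exact: cvg_nnsfun_approx.
have nd x : {homo (fun n => (h n x)%:E) : n m / (n <= m)%N >-> (n <= m)%E}.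
  by move=> a b ab; rewrite lee_fin; exact/lefP/nd_nnsfun_approx.
transitivity (limn (fun n => \int[P]_x (h n x)%:E)%E).
  rewrite -monotone_convergence//.
  - by apply: eq_integral => x _; exact: hg.
  - by move=> n; exact/measurable_EFinP.
  - by move=> n x _; rewrite lee_fin.
transitivity (limn (fun n => \int[mu]_x ((h n x)%:E * (f x)%:E))%E); last first.
  rewrite -monotone_convergence//.
  - apply: eq_integral => x _; rewrite hg -limeMr//; last first.
      by apply: ereal_nondecreasing_is_cvgn => a b ab; exact: nd.
  - by move=> n; apply: emeasurable_funM; apply/measurable_EFinP.
  - by move=> n x _; rewrite mule_ge0// lee_fin.
  - by move=> x _ a b ab; rewrite lee_wpmul2r ?lee_fin//; exact: nd.
congr (limn _); apply/funext => n.
rewrite integralT_nnsfun sintegralE.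
have mindf r : measurable_fun setT (fun x => (r * \1_(h n @^-1` [set r]) x * f x)%:E).
  by apply/measurable_EFinP/measurable_funM => //; exact: measurable_funM.
have ge0 r x : (0 <= (r * \1_(h n @^-1` [set r]) x * f x)%:E)%E.
  by rewrite lee_fin mulr_ge0// -lee_fin; exact: nnfun_muleindic_ge0.
transitivity (\int[mu]_x \sum_(r \in range (h n))
    (r * \1_(h n @^-1` [set r]) x * f x)%:E)%E; last first.
  apply: eq_integral => x _; rewrite -EFinM [in RHS]fimfunE fsumEFin//.
  congr (_%:E); rewrite !fsbig_finite//= mulr_suml//.
rewrite ge0_integral_fsum//; apply: eq_fsbigr => r /[1!inE] rhn.
under [RHS]eq_integral do rewrite -mulrA EFinM.
have r0 : (0 <= r)%R by case: rhn => x _ <-.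
rewrite ge0_integralZl//; last 2 first.
- by apply/measurable_EFinP/measurable_funM.
- by move=> x _; rewrite lee_fin mulr_ge0.
congr (_ * _)%E; rewrite /density_prob [LHS]integral_mkcond; apply: eq_integral => x _.
rewrite patchE indicE; case: ifPn => _; by rewrite ?mul1r ?mul0r.
Qed.

End density.

(** * Quantizing a mixture of blobs *)

(** The integral of a nonnegative function is the supremum of those of the simple
    functions below it, hence is monotone on arbitrary nonnegative functions.  In
    particular a lower bound on the loss of an estimator can be integrated
    pointwise. *)
Lemma ge0_le_integral_nonmeas (disp : measure_display) (T : measurableType disp)
    (R : realType) (mu : {measure set T -> \bar R}) (f g : T -> \bar R) :
  (forall x, (0 <= f x)%E) -> (forall x, (f x <= g x)%E) ->
  (\int[mu]_x f x <= \int[mu]_x g x)%E.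
Proof.
move=> f0 fg; have g0 x : (0 <= g x)%E by exact: le_trans (fg x).
rewrite !ge0_integralTE//; apply: le_ereal_sup => _ [u uf <-].
by exists u => // x; exact: le_trans (uf x) (fg x).
Qed.

Section cost.
Context (R : realType) (d k : nat) (h : R).
Hypothesis h0 : 0 < h.
Implicit Types (x a : d.-tuple R) (c : k.-tuple (d.-tuple R)).

Local Notation lam := (@lebesgue_Rd R d).

Lemma contrast_ge0 c x : (0 <= contrast c x)%E.
Proof.
apply/bigmin_geP; split => [|j _]; first exact: leey.
by rewrite lee_fin sqr_ge0.
Qed.

Lemma measurable_edist_sqr a : measurable_fun setT (fun x => edist x a ^+ 2).
Proof.
under eq_fun do rewrite edist_sqr.
by apply: measurable_sum => s; exact: measurable_coord_sqr.
Qed.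

Lemma measurable_contrast c : measurable_fun setT (contrast c).
Proof.
rewrite /contrast; elim: (index_enum _) => [|j s IH].
  under eq_fun do rewrite big_nil.
  exact: measurable_cst.
under eq_fun do rewrite big_cons.
apply: measurable_mine => //; apply/measurable_EFinP; exact: measurable_edist_sqr.
Qed.

(** The second moment of a blob about its centre. *)
Definition spread : R := d%:R * (h ^+ 2 / 5).

Definition ecost a c : \bar R := (\int[lam]_x (contrast c x * (blob h a x)%:E))%E.

Definition cost a c : R := fine (ecost a c).

Lemma ecost_ge0 a c : (0 <= ecost a c)%E.
Proof.
by apply: integral_ge0 => x _; rewrite mule_ge0 ?contrast_ge0// lee_fin blob_ge0.
Qed.

Lemma cost_ge0 a c : 0 <= cost a c.
Proof. exact/fine_ge0/ecost_ge0. Qed.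

Lemma integral_sqr_blob a p :
  (\int[lam]_x ((edist x p ^+ 2)%:E * (blob h a x)%:E) = (spread + edist a p ^+ 2)%:E)%E.
Proof.
rewrite -(integral_blob_sqr a p h0); apply: eq_integral => x _.
by rewrite -EFinM mulrC.
Qed.

Lemma ecost_le a c j : (ecost a c <= (spread + edist a (tnth c j) ^+ 2)%:E)%E.
Proof.
rewrite -integral_sqr_blob; apply: ge0_le_integral_nonmeas => x.
  by rewrite mule_ge0 ?contrast_ge0// lee_fin blob_ge0.
by rewrite lee_wpmul2r ?lee_fin ?blob_ge0// bigmin_le.
Qed.

Lemma ecostE a c : (0 < k)%N -> ecost a c = (cost a c)%:E.
Proof.
move=> k0; rewrite fineK// ge0_fin_numE ?ecost_ge0//.
exact: le_lt_trans (ecost_le _ _ (Ordinal k0)) (ltry _).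
Qed.

Lemma cost_le a c j : cost a c <= spread + edist a (tnth c j) ^+ 2.
Proof. by rewrite -lee_fin -ecostE ?ecost_le//; case: k j => // -[]. Qed.

Lemma le_ecost a c (g : d.-tuple R -> R) : (forall x, 0 <= g x) ->
  (forall x, edist x a <= d%:R * h -> forall l, g x <= edist x (tnth c l) ^+ 2) ->
  (\int[lam]_x ((g x)%:E * (blob h a x)%:E) <= ecost a c)%E.
Proof.
move=> g0 gc; apply: ge0_le_integral_nonmeas => x.
  by rewrite mule_ge0// lee_fin ?blob_ge0.
have [xa|xa] := leP (edist x a) (d%:R * h); last by rewrite blob_eq0// !mule0.
rewrite lee_wpmul2r ?lee_fin ?blob_ge0//; apply/bigmin_geP; split; first exact: leey.
by move=> l _; rewrite lee_fin gc.
Qed.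

Lemma cost_served a c j :
  (forall x, edist x a <= d%:R * h ->
    forall l, edist x (tnth c j) <= edist x (tnth c l)) ->
  cost a c = spread + edist a (tnth c j) ^+ 2.
Proof.
move=> sj; apply/eqP; rewrite eq_le cost_le/=.
rewrite -lee_fin -ecostE; last by case: k j {sj} => // -[].
rewrite -integral_sqr_blob; apply: le_ecost => [x|x xa l]; first exact: sqr_ge0.
by rewrite ler_pXn2r ?nnegrE ?edist_ge0 ?sj.
Qed.

Lemma le_cost a c (K : R) : (0 < k)%N -> 0 <= K ->
  (forall x, edist x a <= d%:R * h -> forall l, K <= edist x (tnth c l) ^+ 2) ->
  K <= cost a c.
Proof.
move=> k0 K0 cK; rewrite -lee_fin -ecostE//.
apply: (@le_trans _ _ (\int[lam]_x (K%:E * (blob h a x)%:E))%E); last first.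
  exact: (@le_ecost a c (cst K)).
rewrite ge0_integralZl// ?integral_blob ?mule1//.
- apply/measurable_EFinP; exact: measurable_blob.
- by move=> x _; rewrite lee_fin blob_ge0.
Qed.

End cost.

Section mixture.
Context (R : realType) (d : nat) (J : finType).
Variables (h : R) (a : J -> d.-tuple R).
Hypothesis h0 : 0 < h.
Implicit Types (x : d.-tuple R) (W : J -> R).

Local Notation lam := (@lebesgue_Rd R d).

Definition mixture W x : R := \sum_(q : J) W q * blob h (a q) x.

Lemma mixture_ge0 W : (forall q, 0 <= W q) -> forall x, 0 <= mixture W x.
Proof. by move=> W0 x; apply: sumr_ge0 => q _; rewrite mulr_ge0 ?blob_ge0. Qed.

Lemma measurable_mixture W : measurable_fun setT (mixture W).
Proof.
apply: measurable_sum => q; apply: measurable_funM => //; exact: measurable_blob.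
Qed.

Lemma continuous_mixture W : continuous (mixture W).
Proof.
move=> x; rewrite /mixture; elim: (index_enum _) => [|q r IH].
  under eq_fun do rewrite big_nil.
  exact: cst_continuous.
under eq_fun do rewrite big_cons.
apply: (@continuousD R R^o _ (fun y : d.-tuple R => W q * blob h (a q) y)
  (fun y : d.-tuple R => \sum_(t <- r) W t * blob h (a t) y)) => //.
apply: (@continuousM R _ (fun=> W q) (blob h (a q)) x); first exact: cst_continuous.
exact: continuous_blob.
Qed.

Lemma integral_mixture_sub (Q : pred J) W (g : d.-tuple R -> \bar R) :
  (forall q, 0 <= W q) -> measurable_fun setT g -> (forall x, (0 <= g x)%E) ->
  (\int[lam]_x (g x * (\sum_(q | Q q) W q * blob h (a q) x)%:E) =
   \sum_(q | Q q) (W q)%:E * \int[lam]_x (g x * (blob h (a q) x)%:E))%E.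
Proof.
move=> W0 mg g0.
have mgb q : measurable_fun setT (fun x => (g x * (blob h (a q) x)%:E)%E).
  by apply: emeasurable_funM => //; apply/measurable_EFinP; exact: measurable_blob.
have gb0 q x : (0 <= g x * (blob h (a q) x)%:E)%E by rewrite mule_ge0 ?lee_fin ?blob_ge0.
transitivity (\int[lam]_x \sum_(q | Q q) ((W q)%:E * (g x * (blob h (a q) x)%:E)))%E.
  apply: eq_integral => x _; rewrite -sumEFin ge0_sume_distrr; last first.
    by move=> q _; rewrite lee_fin mulr_ge0 ?blob_ge0.
  by apply: eq_bigr => q _; rewrite EFinM muleCA.
under eq_integral do rewrite -big_filter.
rewrite ge0_integral_sum//; last 2 first.
- by move=> q; exact: measurable_funeM.
- by move=> q x _; rewrite mule_ge0// lee_fin.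
rewrite big_filter; apply: eq_bigr => q _.
by rewrite ge0_integralZl// lee_fin.
Qed.

Lemma integral_mixture_sub1 (Q : pred J) W : (forall q, 0 <= W q) ->
  (\int[lam]_x (\sum_(q | Q q) W q * blob h (a q) x)%:E = (\sum_(q | Q q) W q)%:E)%E.
Proof.
move=> W0; have := @integral_mixture_sub Q W (cst 1%E) W0.
move=> /(_ (measurable_cst _) (fun=> lee01)).
under eq_integral do rewrite mul1e.
move=> ->; rewrite -sumEFin; apply: eq_bigr => q _.
by under eq_integral do rewrite mul1e; rewrite integral_blob// mule1.
Qed.

Section mixture_prob.
Variable W : J -> R.
Hypotheses (W0 : forall q, 0 <= W q) (W1 : \sum_q W q = 1).

Lemma integral_mixture : (\int[lam]_x (mixture W x)%:E = 1)%E.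
Proof. by rewrite (integral_mixture_sub1 _ W0) W1. Qed.

Definition mixture_prob : probability (d.-tuple R) R :=
  density_prob (measurable_mixture W) (mixture_ge0 W0) integral_mixture.

Lemma mixture_probE A :
  mixture_prob A = (\int[lam]_(x in A) (mixture W x)%:E)%E.
Proof. by []. Qed.

Lemma mixture_has_continuous_density : has_continuous_density mixture_prob.
Proof.
exists (mixture W); split => [||A _]; [exact: continuous_mixture| |by []].
exact: mixture_ge0.
Qed.

(** The integral over A of a function that vanishes on A is zero whatever the set
    A, for instance a neighbourhood of the boundary of the cells. *)
Lemma mixture_prob_eq0 A :
  (forall q x, A x -> d%:R * h < edist x (a q)) -> mixture_prob A = 0%E.
Proof.
move=> Aa; rewrite mixture_probE integral_mkcond; apply: integral0_eq => x _.
rewrite patchE; case: ifPn => // /[1!inE] /Aa far; congr (_%:E).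
by rewrite /mixture big1// => q _; rewrite blob_eq0 ?mulr0.
Qed.

Lemma le_mixture_prob (Q : pred J) A :
  (forall q x, Q q -> edist x (a q) <= d%:R * h -> A x) ->
  ((\sum_(q | Q q) W q)%:E <= mixture_prob A)%E.
Proof.
move=> QA; rewrite mixture_probE integral_mkcond -integral_mixture_sub1//.
have term0 q x : 0 <= W q * blob h (a q) x by rewrite mulr_ge0 ?blob_ge0.
apply: ge0_le_integral_nonmeas => x; first by rewrite lee_fin sumr_ge0.
rewrite patchE; case: ifPn => [_|/negP]; rewrite ?inE lee_fin.
  by rewrite /mixture [leRHS](bigID Q)/= lerDl sumr_ge0.
move=> nA; rewrite big1// => q Qq; rewrite blob_eq0 ?mulr0// ltNge.
by apply/negP => /(QA _ _ Qq).
Qed.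

Lemma risk_mixture k (c : k.-tuple (d.-tuple R)) : (0 < k)%N ->
  risk mixture_prob c = (\sum_q W q * cost h (a q) c)%:E.
Proof.
move=> k0; rewrite /risk integral_density_prob//; last 2 first.
- exact: measurable_contrast.
- exact: contrast_ge0.
rewrite [LHS](integral_mixture_sub xpredT)//; last 2 first.
- exact: measurable_contrast.
- exact: contrast_ge0.
by rewrite -sumEFin; apply: eq_bigr => q _; rewrite -/(ecost _ _ _) ecostE.
Qed.

End mixture_prob.

End mixture.

(** * Pairs of blobs *)

Section pair_point.
Context (R : realType) (d : nat) (Dl : R).
Implicit Types (z c : d.-tuple R) (s : bool).

Definition pair_point z s : d.-tuple R :=
  [tuple tnth z t + (if t == 0%N :> nat then (-1) ^+ s * (Dl / 2) else 0) | t < d].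

(** Apollonius' identity: the mean square distance to two points is that to their
    midpoint increased by the square of half their distance. *)
Lemma pair_point_midpoint z c : (0 < d)%N ->
  (edist (pair_point z false) c ^+ 2 + edist (pair_point z true) c ^+ 2) / 2 =
  Dl ^+ 2 / 4 + edist z c ^+ 2.
Proof.
move=> d0; rewrite !edist_sqr -big_split/= mulr_suml.
rewrite (bigD1 (Ordinal d0))//= [in RHS](bigD1 (Ordinal d0))//= !tnth_mktuple/=.
rewrite (eq_bigr (fun t => (tnth z t - tnth c t) ^+ 2)); last first.
  move=> t t0; rewrite !tnth_mktuple.
  have /negbTE -> : t != 0%N :> nat by move: t0; rewrite -val_eqE.
  by rewrite addr0; field.
by rewrite expr1 expr0; field.
Qed.

Lemma edist_pair_point_mid z s : (0 < d)%N -> 0 < Dl ->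
  edist (pair_point z s) z = Dl / 2.
Proof.
move=> d0 Dl0; have Dl2 : 0 <= Dl / 2 by rewrite divr_ge0 ?ltW.
rewrite -[RHS]ger0_norm// -sqrtr_sqr /edist; congr Num.sqrt.
rewrite (bigD1 (Ordinal d0))//= big1 => [|t t0]; rewrite !tnth_mktuple/=.
  by case: s => /=; rewrite ?expr1 ?expr0; ring.
have /negbTE -> : t != 0%N :> nat by move: t0; rewrite -val_eqE.
by ring.
Qed.

Lemma edist_pair_point z s : (0 < d)%N -> 0 < Dl ->
  edist (pair_point z s) (pair_point z (~~ s)) = Dl.
Proof.
move=> d0 Dl0; rewrite -[RHS]ger0_norm ?ltW// -sqrtr_sqr /edist; congr Num.sqrt.
rewrite (bigD1 (Ordinal d0))//= big1 => [|t t0]; rewrite !tnth_mktuple/=.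
  by case: s => /=; rewrite ?expr1 ?expr0; field.
have /negbTE -> : t != 0%N :> nat by move: t0; rewrite -val_eqE.
by ring.
Qed.

End pair_point.

(** Linear arithmetic in which distances, costs and the second moment are replaced
    by variables: its preprocessing would otherwise try to unfold them. *)
Ltac metric_lra :=
  repeat match goal with
  | H : is_true (Order.le _ _) |- _ => revert H
  | H : is_true (Order.lt _ _) |- _ => revert H
  | H : @eq (Real.sort _) _ _ |- _ => revert H
  end;
  repeat match goal with H : @eq _ _ _ |- _ => clear H end;
  repeat match goal with
  | |- context [edist ?x ?y] => generalize (edist x y)
  | |- context [cost ?h ?a ?c] => generalize (cost h a c)
  | |- context [spread ?d ?h] => generalize (spread d h)
  end; repeat (let H := fresh "H" in intro H); lra.

(** Numerical core of the case of two codes near a pair.  Here A0 and A1 are the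
    distances of the two blob centres to their nearest codes, B0 and B1 lower
    bounds on the distances of the points of the blobs to these codes, and e0 and
    e1 the costs of the blobs: since e0 + e1 is small so is B0 + B1, by the
    inequality (B0 + B1)^2 <= 2 (B0^2 + B1^2), and then so is A0 + A1. *)
Lemma pair_distance_bound (R : realFieldType) (Dl v e0 e1 B0 B1 A0 A1 : R) :
  (e0 + e1) / 2 < v + Dl ^+ 2 / 8 -> v <= Dl ^+ 2 / 100 ->
  B0 ^+ 2 <= e0 -> B1 ^+ 2 <= e1 -> 0 <= B0 -> 0 <= B1 ->
  A0 <= B0 + Dl / 100 -> A1 <= B1 + Dl / 100 -> 0 < Dl -> A0 + A1 <= 4 / 5 * Dl.
Proof.
move=> lt vD eB0 eB1 B00 B10 AB0 AB1 D0.
have B0B1 : 0 <= B0 + B1 by exact: addr_ge0.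
have D34 : 0 <= 3 / 4 * Dl by lra.
have : (B0 + B1) ^+ 2 <= (3 / 4 * Dl) ^+ 2.
  have := sqr_ge0 (B0 - B1); have : 0 < Dl ^+ 2 by rewrite exprn_gt0.
  move: lt vD eB0 eB1; rewrite exprMn sqrrB sqrrD; lra.
by rewrite (ler_pXn2r (isT : (0 < 2)%N) B0B1 D34); lra.
Qed.

#[local] Opaque cost edist.

Section pair_cost.
Context (R : realType) (d k : nat) (I : finType) (Dl : R) (z : I -> d.-tuple R).
Hypotheses (d_gt0 : (0 < d)%N) (k_gt0 : (0 < k)%N) (Dl_gt0 : 0 < Dl).
Hypothesis z_sep : forall i i', i != i' -> 5 * Dl <= edist (z i) (z i').
Implicit Types (i : I) (s : bool) (x : d.-tuple R) (c : k.-tuple (d.-tuple R)).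
Implicit Types (l : 'I_k).

Definition blob_width : R := Dl / 100 / d%:R.

Local Notation h := blob_width.
Local Notation rho := (Dl / 100).
Local Notation v := (spread d h).

Lemma blob_width_gt0 : 0 < h.
Proof.
apply: divr_gt0; last by rewrite ltr0n.
by move: Dl_gt0; lra.
Qed.

Local Notation h0 := blob_width_gt0.

Lemma blob_radius : d%:R * h = rho.
Proof. by rewrite /blob_width mulrC divfK// pnatr_eq0 -lt0n. Qed.

Lemma spread_le : v <= Dl ^+ 2 / 100.
Proof.
have dR : 1 <= d%:R :> R by rewrite ler1n.
have -> : v = rho ^+ 2 / (5 * d%:R).
  by rewrite /spread /blob_width; field; rewrite pnatr_eq0 -lt0n.
apply: (@le_trans _ _ (rho ^+ 2 / 1)).
  apply: ler_pM; rewrite ?invr_ge0; [exact: sqr_ge0|lra|by []|].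
  by rewrite lef_pV2 ?posrE; lra.
by rewrite divr1 expr_div_n ler_pdivrMr; have := sqr_ge0 Dl; lra.
Qed.

#[local] Opaque spread.

Definition ctr i s := pair_point Dl (z i) s.

Lemma ctr_midpoint i x :
  (edist (ctr i false) x ^+ 2 + edist (ctr i true) x ^+ 2) / 2 =
  Dl ^+ 2 / 4 + edist (z i) x ^+ 2.
Proof. exact: pair_point_midpoint. Qed.

Lemma edist_ctr_mid i s : edist (ctr i s) (z i) = Dl / 2.
Proof. exact: edist_pair_point_mid. Qed.

Lemma edist_ctr i s : edist (ctr i s) (ctr i (~~ s)) = Dl.
Proof. exact: edist_pair_point. Qed.

#[local] Opaque ctr.

Definition pcost i c : R := (cost h (ctr i false) c + cost h (ctr i true) c) / 2.

Lemma pcostE i c :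
  pcost i c = (cost h (ctr i false) c + cost h (ctr i true) c) / 2.
Proof. by []. Qed.

(** The balls of radius 2 Delta about the centres of the pairs are disjoint, so
    that a code is near at most one pair; a code that is near no pair is too far to
    be of use. *)
Definition near i c : {set 'I_k} := [set l | edist (tnth c l) (z i) <= 2 * Dl].

Lemma pcost_ge0 i c : 0 <= pcost i c.
Proof. by rewrite divr_ge0// addr_ge0// cost_ge0 ?h0. Qed.

Lemma near_inj i i' c l : l \in near i c -> l \in near i' c -> i = i'.
Proof.
rewrite !inE => li li'; apply/eqP; apply: contraT => /z_sep.
have := edist_triangle (tnth c l) (z i) (z i'); rewrite (edistC (z i) (tnth c l)).
metric_lra.
Qed.

Lemma sum_near_le c : (\sum_i #|near i c| <= k)%N.
Proof.
under eq_bigr do rewrite -sum1_card.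
rewrite (exchange_big_dep xpredT)//= -[leqRHS]card_ord -sum1_card.
apply: leq_sum => l _; case: (pickP (fun i => l \in near i c)) => [i li|no].
  by rewrite (bigD1 i)//= big1 ?addn0// => i' /andP[/(near_inj li) -> ]; rewrite eqxx.
by rewrite big1// => i; rewrite no.
Qed.

Lemma far_blob i s c l x : l \notin near i c -> edist x (ctr i s) <= rho ->
  (3 / 2 - 1 / 100) * Dl <= edist x (tnth c l).
Proof.
rewrite inE -ltNge => far xc.
have := edist_triangle x (tnth c l) (z i).
have := edist_triangle (ctr i s) x (z i).
rewrite edist_ctr_mid (edistC (tnth c l) x); move: Dl_gt0 xc far.
metric_lra.
Qed.

Lemma le_blob_cost i s c (t : R) : 0 <= t ->
  (forall l x, edist x (ctr i s) <= rho -> t <= edist x (tnth c l)) ->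
  t ^+ 2 <= cost h (ctr i s) c.
Proof.
move=> t0 tc; apply: le_cost => //; [exact: h0|exact: sqr_ge0|].
move=> x; rewrite blob_radius => xs l.
by rewrite ler_pXn2r ?nnegrE ?edist_ge0// tc.
Qed.

Lemma blob_cost_served i s c l :
  (forall x l', edist x (ctr i s) <= rho -> edist x (tnth c l) <= edist x (tnth c l')) ->
  cost h (ctr i s) c = v + edist (ctr i s) (tnth c l) ^+ 2.
Proof.
move=> sl; apply: cost_served; first exact: h0.
by move=> x; rewrite blob_radius => xs l'; exact: sl.
Qed.

Lemma pcost_near0 i c : #|near i c| = 0 -> 9 / 5 * Dl ^+ 2 <= pcost i c.
Proof.
move/eqP; rewrite cards_eq0 => /eqP n0.
have e s : (7 / 5 * Dl) ^+ 2 <= cost h (ctr i s) c.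
  apply: le_blob_cost => [|l x xs]; first by metric_lra.
  have := @far_blob i s c l x; rewrite n0 inE => /(_ isT xs); metric_lra.
rewrite /pcost; have := e true; have := e false; have := sqr_ge0 Dl.
by metric_lra.
Qed.

(** A single code within 19/20 Delta of the midpoint serves both blobs, as it is
    nearer to their points than any code outside the ball of radius 2 Delta.  A
    single code further away is at least 53/50 Delta away from one of the two blob
    centres, since (53/50)^2 < 1/4 + (19/20)^2. *)
Lemma pcost_near1 i c : #|near i c| = 1 ->
  (exists2 l, l \in near i c &
     pcost i c = v + Dl ^+ 2 / 4 + edist (z i) (tnth c l) ^+ 2) \/
  11 / 20 * Dl ^+ 2 <= pcost i c.
Proof.
move/eqP/cards1P => [l nl].
have far l' : l' != l -> l' \notin near i c by rewrite nl inE.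
set q := edist (z i) (tnth c l).
have [ql|ql] := leP q (19 / 20 * Dl).
  left; exists l; first by rewrite nl inE.
  rewrite -addrA -ctr_midpoint /pcost.
  have sv s : cost h (ctr i s) c = v + edist (ctr i s) (tnth c l) ^+ 2.
    apply: blob_cost_served => x l' xs; have [->//|/far/far_blob] := eqVneq l' l.
    move=> /(_ _ _ xs); have := edist_triangle (ctr i s) x (tnth c l).
    have := edist_triangle (z i) (ctr i s) (tnth c l).
    rewrite -/q edist_ctr_mid; metric_lra.
  by rewrite !sv; field.
right; have [s sfar] : exists s, 21 / 20 * Dl + rho <= edist (ctr i s) (tnth c l).
  apply: contrapT => /forallNP no.
  have lt s : edist (ctr i s) (tnth c l) ^+ 2 <= (53 / 50 * Dl) ^+ 2.
    have /negP := no s; rewrite -ltNge => lts.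
    by rewrite ler_pXn2r ?nnegrE ?edist_ge0//; metric_lra.
  have := ctr_midpoint i (tnth c l); rewrite -/q.
  have : (19 / 20 * Dl) ^+ 2 <= q ^+ 2.
    by rewrite ler_pXn2r ?nnegrE ?edist_ge0//; metric_lra.
  have := lt true; have := lt false; have : 0 < Dl ^+ 2 by rewrite exprn_gt0.
  metric_lra.
have e : (21 / 20 * Dl) ^+ 2 <= cost h (ctr i s) c.
  apply: le_blob_cost => [|l' x xs]; first by metric_lra.
  have [->|/far/far_blob] := eqVneq l' l.
    have := edist_triangle x (ctr i s) (tnth c l); rewrite (edistC _ x).
    by metric_lra.
  by move=> /(_ _ _ xs); metric_lra.
have := cost_ge0 h0 (ctr i (~~ s)) c; have := sqr_ge0 Dl.
by rewrite /pcost; case: s e {sfar} => /= e; metric_lra.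
Qed.

(** The threshold lies halfway between the least costs with two codes and with one.
    Below it, the two blobs are close to distinct codes, each serving its own
    blob. *)
Lemma pcost_near2 i c : #|near i c| = 2 ->
  (exists2 p : bool -> 'I_k, [/\ p false \in near i c, p true \in near i c
      & p false != p true] &
     pcost i c = v + (edist (ctr i false) (tnth c (p false)) ^+ 2
                    + edist (ctr i true) (tnth c (p true)) ^+ 2) / 2) \/
  v + Dl ^+ 2 / 8 <= pcost i c.
Proof.
move=> n2; have [lt|] := ltP (pcost i c) (v + Dl ^+ 2 / 8); last by right.
left.
have /choice[p pA] : forall s, exists l, forall l',
    edist (ctr i s) (tnth c l) <= edist (ctr i s) (tnth c l').
  move=> s; exists [arg min_(l < Ordinal k_gt0) edist (ctr i s) (tnth c l)]%O.
  by case: arg_minP => // l' _ + l; exact.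
pose A s := edist (ctr i s) (tnth c (p s)).
have AE s : edist (ctr i s) (tnth c (p s)) = A s by [].
clearbody A.
have AA : A false + A true <= 4 / 5 * Dl.
  have e s : exists B, [/\ 0 <= B, A s <= B + rho & B ^+ 2 <= cost h (ctr i s) c].
    exists (Num.max 0 (A s - rho)); split; first by rewrite le_max lexx.
      by rewrite -lerBlDr le_max lexx orbT.
    apply: le_blob_cost => [|l x xs]; first by rewrite le_max lexx.
    rewrite ge_max edist_ge0/= lerBlDr -AE (le_trans (pA s l))//.
    by rewrite addrC (le_trans (edist_triangle x _ _))// lerD2r edistC.
  have [B0 [B00 AB0 eB0]] := e false; have [B1 [B10 AB1 eB1]] := e true.
  exact: pair_distance_bound lt spread_le eB0 eB1 B00 B10 AB0 AB1 Dl_gt0.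
have A0 s : 0 <= A s by rewrite -AE edist_ge0.
have Ale s : A s <= 4 / 5 * Dl.
  by apply: le_trans AA; case: s; rewrite ?lerDl ?lerDr.
have pnear s : p s \in near i c.
  rewrite inE edistC; have := edist_triangle (ctr i s) (z i) (tnth c (p s)).
  have := Ale s; rewrite (edistC (z i) (ctr i s)) AE edist_ctr_mid.
  metric_lra.
have pneq : p false != p true.
  apply/eqP => pe; have := edist_triangle (tnth c (p false)) (ctr i false) (ctr i true).
  have -> : edist (tnth c (p false)) (ctr i true) = A true by rewrite pe edistC AE.
  rewrite AE (edist_ctr i false).
  by metric_lra.
have only l : l \in near i c -> exists s, l = p s.
  have sub : [set p false; p true]%SET \subset near i c.
    by apply/fintype.subsetP => l'; rewrite in_set2 => /orP[] /eqP ->.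
  have /subset_leqif_cards/leqifP := sub; rewrite n2 cards2 pneq /=.
  case: eqVneq => // <- _; rewrite in_set2.
  by move=> /orP[] /eqP ->; [exists false|exists true].
exists p; first by split.
have sv s : cost h (ctr i s) c = v + A s ^+ 2.
  rewrite -AE; apply: blob_cost_served => x l' xs.
  have := edist_triangle (ctr i s) x (tnth c (p s)); rewrite AE.
  have [/only[s' ->]|/far_blob] := boolP (l' \in near i c); last first.
    move=> /(_ _ _ xs); have := Ale s; metric_lra.
  have [->//|ss] := eqVneq s' s.
  have {ss} -> : s' = ~~ s by case: s s' ss {xs} => -[].
  have := edist_triangle (tnth c (p (~~ s))) (ctr i s) (ctr i (~~ s)).
  rewrite (edistC (tnth _ _) (ctr i (~~ s))) AE edist_ctr.
  have := edist_triangle x (ctr i s) (tnth c (p (~~ s))); rewrite (edistC _ x).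
  have : A s + A (~~ s) <= 4 / 5 * Dl by case: (s) => //; rewrite addrC.
  metric_lra.
by rewrite /pcost !sv !AE; field.
Qed.

End pair_cost.

(** * Risk of a codebook under a perturbed uniform mixture *)

Section sums.
Context (R : realType) (j : nat).

Lemma sum_pair_index (V : nmodType) (th : 'I_j -> bool) (F : 'I_j * bool -> V) :
  \sum_i F i = \sum_l (F (l, th l) + F (l, ~~ th l)).
Proof.
rewrite (eq_bigr (fun i => F (i.1, i.2))); last by case.
rewrite -(pair_bigA _ (fun l s => F (l, s)))/=; apply: eq_bigr => l _.
by rewrite big_bool; case: (th l); rewrite // addrC.
Qed.

Lemma sum_code_index (V : nmodType) (F : 'I_j * option bool -> V) :
  \sum_q F q = \sum_l (F (l, Some false) + F (l, Some true) + F (l, None)).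
Proof.
rewrite (eq_bigr (fun i => F (i.1, i.2))); last by case.
rewrite -(pair_bigA _ (fun l s => F (l, s)))/=; apply: eq_bigr => l _.
rewrite (bigD1 (Some false))//= (bigD1 (Some true))//= (bigD1 None)//= big1 ?addr0 ?addrA//.
by case=> [[]|].
Qed.

End sums.

(** * Codebooks adapted to a sign vector *)

Section codes.
Context (R : realType) (d j : nat) (Dl : R) (z : 'I_j * bool -> d.-tuple R).
Hypotheses (d_gt0 : (0 < d)%N) (Dl_gt0 : 0 < Dl).
Hypothesis z_sep : forall i i', i != i' -> 5 * Dl <= edist (z i) (z i').

Local Notation k := (j * 3)%N.
Local Notation ctr := (ctr Dl z).

Implicit Types (th : 'I_j -> bool) (i : 'I_j * bool) (q : 'I_j * option bool).

(** The three codes of couple q.1: [Some s] stands for those placed on the two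
    blobs of the heavy pair (q.1, th q.1), and [None] for the one placed at the
    midpoint of the light pair. *)
Definition code_point th q : d.-tuple R :=
  match q.2 with
  | Some s => ctr (q.1, th q.1) s
  | None => z (q.1, ~~ th q.1)
  end.

Definition code_center th q : 'I_j * bool :=
  (q.1, if q.2 is Some _ then th q.1 else ~~ th q.1).

Lemma edist_code_center th q : edist (code_point th q) (z (code_center th q)) <= Dl / 2.
Proof.
rewrite /code_point /code_center; case: q.2 => [s|]; rewrite ?edist_ctr_mid ?edistxx//.
by rewrite divr_ge0 ?ltW.
Qed.

Lemma code_center_far th q i : code_center th q != i ->
  9 / 2 * Dl <= edist (z i) (code_point th q).
Proof.
move=> /z_sep; have := edist_code_center th q.
have := edist_triangle (code_point th q) (z (code_center th q)) (z i).
rewrite (edistC (z (code_center _ _)) (code_point _ _)) (edistC (z i)).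
metric_lra.
Qed.

Lemma code_point_sep th q q' : q != q' ->
  Dl <= edist (code_point th q) (code_point th q').
Proof.
move=> qq'; have [e|/code_center_far far] := eqVneq (code_center th q') (code_center th q).
  move: e qq'; rewrite /code_center /code_point.
  case: q q' => [l [s|]] [l' [s'|]] /= [->].
  - move=> _ ss; have -> : s' = ~~ s by case: s s' ss => -[]//; rewrite eqxx.
    by rewrite edist_ctr.
  - by case: (th l).
  - by case: (th l).
  - by rewrite eqxx.
have := edist_triangle (code_point th q) (z (code_center th q)) (code_point th q').
have := edist_code_center th q; move: far.
rewrite (edistC (z _) (code_point th q)); metric_lra.
Qed.

Lemma card_code : #|{: 'I_j * option bool}| = k.
Proof. by rewrite card_prod card_ord card_option card_bool. Qed.

Definition code_index q : 'I_k := cast_ord card_code (enum_rank q).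

Definition index_code (l : 'I_k) : 'I_j * option bool :=
  enum_val (cast_ord (esym card_code) l).

Lemma code_indexK : cancel code_index index_code.
Proof. by move=> q; rewrite /index_code /code_index cast_ordK enum_rankK. Qed.

Lemma index_codeK : cancel index_code code_index.
Proof. by move=> l; rewrite /index_code /code_index enum_valK cast_ordKV. Qed.

Definition codebook th : k.-tuple (d.-tuple R) :=
  [tuple code_point th (index_code l) | l < k].

Lemma tnth_codebook th q : tnth (codebook th) (code_index q) = code_point th q.
Proof. by rewrite tnth_mktuple code_indexK. Qed.

Lemma code_index_surj l : exists q, l = code_index q.
Proof. by exists (index_code l); rewrite index_codeK. Qed.

End codes.

Section perturbed.
Context (R : realType) (d j : nat) (Dl delta : R) (z : 'I_j * bool -> d.-tuple R).
Hypotheses (d_gt0 : (0 < d)%N) (j_gt0 : (0 < j)%N) (Dl_gt0 : 0 < Dl).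
Hypothesis z_sep : forall i i', i != i' -> 5 * Dl <= edist (z i) (z i').
Hypotheses (delta_gt0 : 0 < delta) (delta_le : delta <= 1 / 3).

Local Notation k := (j * 3)%N.
Local Notation h := (blob_width d Dl).
Local Notation rho := (Dl / 100).
Local Notation v := (spread d h).
Local Notation ctr := (ctr Dl z).
Local Notation pcost := (pcost Dl z).
Local Notation near := (near Dl z).
Local Notation code_point := (code_point Dl z).
Local Notation codebook := (codebook Dl z).
Local Notation m := (j%:R * 2 : R).

Implicit Types (th : 'I_j -> bool) (i : 'I_j * bool) (c : k.-tuple (d.-tuple R)).
Implicit Types (q : 'I_j * option bool).

Let k_gt0 : (0 < k)%N. Proof. by rewrite muln_gt0 j_gt0. Qed.

Let m_gt0 : 0 < m. Proof. by rewrite mulr_gt0 ?ltr0n. Qed.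

Definition heavy th i : bool := i.2 == th i.1.

Definition tilt th i : R := if heavy th i then 1 + delta else 1 - delta.

Definition weight th i : R := tilt th i / m.

Lemma weightE th i : weight th i = tilt th i / m.
Proof. by []. Qed.

(** What a second code saves on a pair of mass 1/m.  On a heavy or light pair, the
    saving differs from the price by delta * price. *)
Definition price : R := Dl ^+ 2 / (4 * m).

Local Ltac risk_lra :=
  repeat match goal with
  | H : is_true (Order.le _ _) |- _ => revert H
  | H : is_true (Order.lt _ _) |- _ => revert H
  | H : @eq (Real.sort _) _ _ |- _ => revert H
  end;
  repeat match goal with
  | |- context [pcost ?i ?c] => generalize (pcost i c)
  | |- context [weight ?t ?i] => generalize (weight t i)
  end;
  generalize price; metric_lra.

Lemma price_gt0 : 0 < price.
Proof. by rewrite divr_gt0 ?exprn_gt0 ?mulr_gt0 ?ltr0n. Qed.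

Lemma tilt_bounds th i : 2 / 3 <= tilt th i <= 4 / 3.
Proof.
by rewrite /tilt; case: ifP => _; move: delta_gt0 delta_le; lra.
Qed.

Lemma weight_gt0 th i : 0 < weight th i.
Proof. by rewrite divr_gt0//; have := tilt_bounds th i; lra. Qed.

Lemma weight_sum th : \sum_i weight th i = 1.
Proof.
rewrite (sum_pair_index th) (eq_bigr (fun=> j%:R^-1)); last first.
  move=> l _; rewrite /weight /tilt /heavy /= eqxx.
  by case: (th l) => /=; field; rewrite pnatr_eq0 -lt0n.
by rewrite sumr_const card_ord -[LHS]mulr_natl mulfV// pnatr_eq0 -lt0n.
Qed.

Definition prisk th c : R := \sum_i weight th i * pcost i c.

Definition ropt : R := v + (1 - delta) * Dl ^+ 2 / 8.

(** The cost of a pair, the codes near it being charged, above the optimum of this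
    charged cost: 2 * price for two codes on a heavy pair, (2 - delta) * price for
    one code on a light pair. *)
Definition excess th i c : R := weight th i * (pcost i c - v)
  + price * #|near i c|%:R - (if heavy th i then 2 * price else (2 - delta) * price).

(** The optimal charged costs add up to the optimal risk and the price of k codes,
    so that a codebook is charged for its excesses and for its codes that are near
    no pair. *)
Lemma prisk_excess th c : prisk th c - ropt =
  \sum_i excess th i c + price * (k%:R - (\sum_i #|near i c|)%N%:R).
Proof.
rewrite /excess sumrB big_split/= -mulr_sumr natr_sum.
rewrite [X in _ + _ - X](sum_pair_index th) /heavy/=.
rewrite [X in _ + _ - X](eq_bigr (fun=> (4 - delta) * price)); last first.
  by move=> l _; rewrite eqxx; case: (th l) => /=; ring.
rewrite sumr_const card_ord -mulr_natl natrM.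
have -> : \sum_i weight th i * (pcost i c - v) = prisk th c - v.
  under eq_bigr do rewrite mulrBr.
  by rewrite sumrB -mulr_suml weight_sum mul1r.
rewrite /ropt /price; field; by rewrite pnatr_eq0 -lt0n.
Qed.

Lemma weight_price th i (t y : R) : t * Dl ^+ 2 <= y ->
  4 * t * price * tilt th i <= weight th i * y.
Proof.
move=> ty; have -> : 4 * t * price * tilt th i = weight th i * (t * Dl ^+ 2).
  by rewrite /price /weight; field; rewrite pnatr_eq0 -lt0n.
by rewrite ler_pM2l// weight_gt0.
Qed.

(** Exchanging heavy and light turns misfits into their opposites, which the
    testing argument requires.  So a light pair with no code does not count as a
    misfit, although its excess is large ([excess_near0]). *)
Definition misfit th i c : bool := (1 < #|near i c|)%N != heavy th i.

Let v_le : v <= Dl ^+ 2 / 100. Proof. exact: spread_le. Qed.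
Let dprice_gt0 : 0 < delta * price. Proof. by rewrite mulr_gt0 ?price_gt0. Qed.
Let dprice_le : delta * price <= price / 3.
Proof. by rewrite mulrC -[3^-1]mul1r ler_pM2l ?price_gt0. Qed.
Let Dl2_gt0 : 0 < Dl ^+ 2. Proof. by rewrite exprn_gt0. Qed.

Lemma excess_near0 th i c : #|near i c| = 0 -> 2 * delta * price < excess th i c.
Proof.
move=> n0; have := @pcost_near0 _ _ _ _ _ z d_gt0 k_gt0 Dl_gt0 i c n0 => p0.
have := @weight_price th i (17 / 10) (pcost i c - v).
rewrite /excess n0 mulr0 addr0 /tilt => /(_ _) wp.
have {wp} := wp ltac:(by move: v_le Dl2_gt0; risk_lra).
by move: price_gt0 dprice_gt0 dprice_le; case: ifP => _; risk_lra.
Qed.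

Lemma excess_near3 th i c : (2 < #|near i c|)%N -> 2 * delta * price < excess th i c.
Proof.
move=> n3; have p0 := @pcost_ge0 _ _ k _ _ z d_gt0 Dl_gt0 i c.
have := @weight_price th i (- 1 / 100) (pcost i c - v).
rewrite /excess /tilt => /(_ _) wp.
have {wp} := wp ltac:(by move: v_le Dl2_gt0; risk_lra).
have : 3 * price <= price * #|near i c|%:R.
  by rewrite mulrC ler_pM2l ?price_gt0// (ler_nat _ 3).
by move: price_gt0 dprice_gt0 dprice_le; case: ifP => _; risk_lra.
Qed.

Lemma excess_near1 th i c : #|near i c| = 1 ->
  (exists2 l, l \in near i c & excess th i c = (if heavy th i then delta * price else 0)
     + weight th i * edist (z i) (tnth c l) ^+ 2) \/
  2 * delta * price < excess th i c.
Proof.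
move=> n1; have [[l ln pE]|p1] := @pcost_near1 _ _ _ _ _ z d_gt0 k_gt0 Dl_gt0 i c n1.
  left; exists l => //; rewrite /excess n1 mulr1 pE.
  rewrite /weight /tilt /price; case: ifP => _; field; by rewrite pnatr_eq0 -lt0n.
right; have := @weight_price th i (27 / 50) (pcost i c - v).
rewrite /excess n1 mulr1 /tilt => /(_ _) wp.
have {wp} := wp ltac:(by move: v_le Dl2_gt0; risk_lra).
by move: price_gt0 dprice_gt0 dprice_le; case: ifP => _; risk_lra.
Qed.

(** In the second case the cost of the pair is at least the second moment plus
    Delta^2/8, so that the excess of a heavy pair is at least (1 + delta)/2 times
    the price; the bound delta <= 1/3 makes this at least 2 * delta * price. *)
Lemma excess_near2 th i c : #|near i c| = 2 ->
  (exists2 p : bool -> 'I_k, [/\ p false \in near i c, p true \in near i c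
      & p false != p true] &
     excess th i c = (if heavy th i then 0 else delta * price)
      + weight th i * ((edist (ctr i false) (tnth c (p false)) ^+ 2
                    + edist (ctr i true) (tnth c (p true)) ^+ 2) / 2)) \/
  (if heavy th i then 2 * delta * price else delta * price) <= excess th i c.
Proof.
move=> n2; have [[p pn pE]|p2] := @pcost_near2 _ _ _ _ _ z d_gt0 k_gt0 Dl_gt0 i c n2.
  left; exists p => //; rewrite /excess n2 pE.
  rewrite /weight /tilt /price; case: ifP => _; field; by rewrite pnatr_eq0 -lt0n.
right; have := @weight_price th i (1 / 8) (pcost i c - v).
rewrite /excess n2 /tilt => /(_ _) wp.
have {wp} := wp ltac:(by move: v_le Dl2_gt0; risk_lra).
by move: price_gt0 dprice_gt0 dprice_le; case: ifP => _; risk_lra.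
Qed.

Lemma excess_ge th i c : delta * price * (misfit th i c)%:R <= excess th i c.
Proof.
have wsq (l : 'I_k) x : 0 <= weight th i * edist x (tnth c l) ^+ 2.
  by rewrite mulr_ge0 ?sqr_ge0// ltW ?weight_gt0.
have dp : 2 * delta * price = delta * price *+ 2 by ring.
have b1 (b : bool) : delta * price * b%:R <= delta * price.
  by case: b; rewrite ?mulr1 ?mulr0 ?lexx ?(ltW dprice_gt0).
have gt2 : 2 * delta * price < excess th i c -> delta * price * (misfit th i c)%:R <= excess th i c.
  rewrite dp => gt; apply/ltW/le_lt_trans/gt/(le_trans (b1 _)).
  by rewrite mulr2n lerDl ltW ?dprice_gt0.
case nE : #|near i c| => [|[|[|n]]].
- exact/gt2/excess_near0.
- have [[l _ eE]|/gt2//] := excess_near1 th nE.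
  by rewrite eE /misfit nE /=; case: (heavy th i); rewrite /= ?mulr1 ?mulr0 ?lerDl ?add0r wsq.
- have [[p _ eE]|] := excess_near2 th nE.
    have : 0 <= weight th i * ((edist (ctr i false) (tnth c (p false)) ^+ 2
                    + edist (ctr i true) (tnth c (p true)) ^+ 2) / 2).
      apply: mulr_ge0; first exact: ltW (weight_gt0 _ _).
      by apply: divr_ge0 => //; apply: addr_ge0; exact: sqr_ge0.
    by rewrite eE /misfit nE /=; case: (heavy th i); rewrite ?mulr1 ?mulr0 ?lerDl ?add0r.
  rewrite /misfit nE /=; case: (heavy th i) => /=; rewrite ?mulr1 ?mulr0//.
  by apply: le_trans; rewrite dp mulrn_wge0// ltW ?dprice_gt0.
- by apply/gt2/excess_near3; rewrite nE.
Qed.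

Lemma excess_ge0 th i c : 0 <= excess th i c.
Proof.
apply: le_trans (excess_ge th i c); apply: mulr_ge0 => //.
exact: ltW dprice_gt0.
Qed.

(** The excesses bound the risk from below because at most k codes can be near
    the pairs. *)
Lemma prisk_ge th c :
  ropt + delta * price * (\sum_i misfit th i c)%N%:R <= prisk th c.
Proof.
rewrite -lerBrDl prisk_excess natr_sum mulr_sumr.
apply: le_trans (_ : \sum_i excess th i c <= _).
  by apply: ler_sum => i _; exact: excess_ge.
rewrite lerDl mulr_ge0 ?(ltW price_gt0)// subr_ge0 ler_nat.
exact: sum_near_le.
Qed.

Definition target th i : nat := if heavy th i then 2%N else 1%N.

Lemma sum_target th : (\sum_i target th i = k)%N.
Proof.
rewrite (sum_pair_index th) (eq_bigr (fun=> 3%N)); last first.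
  by move=> l _; rewrite /target /heavy/= eqxx; case: (th l).
by rewrite sum_nat_const card_ord.
Qed.

Lemma near_target th i c : excess th i c < 2 * delta * price -> ~~ misfit th i c ->
  #|near i c| = target th i.
Proof.
move=> lt; rewrite /misfit /target negbK.
case nE : #|near i c| => [|[|[|n]]] /eqP <- //.
- by move: lt; rewrite ltNge ltW// excess_near0.
- by move: lt; rewrite ltNge ltW// excess_near3// nE.
Qed.

(** Two misfits already cost 2 * delta * price.  A single misfit leaves all other
    pairs with the right numbers of codes, which add up to k with the right number
    for the misfit pair; as that pair cannot have too many codes, a code is near no
    pair and its price is lost. *)
Lemma prisk_lt_fit th c : prisk th c < ropt + 2 * delta * price ->
  (forall i, #|near i c| = target th i /\ excess th i c < 2 * delta * price) /\
  prisk th c = ropt + \sum_i excess th i c.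
Proof.
rewrite -ltrBlDl => lt; have slack := prisk_excess th c.
have kn : (\sum_i #|near i c| <= k)%N by exact: sum_near_le.
have kn0 : 0 <= price * (k%:R - (\sum_i #|near i c|)%N%:R).
  by rewrite mulr_ge0 ?(ltW price_gt0)// subr_ge0 ler_nat.
have sumlt : \sum_i excess th i c < 2 * delta * price.
  by apply: le_lt_trans lt; rewrite slack lerDl.
have lti i : excess th i c < 2 * delta * price.
  apply: le_lt_trans sumlt; rewrite (bigD1 i)//= lerDl.
  by apply: sumr_ge0 => i' _; exact: excess_ge0.
have fit i : ~~ misfit th i c.
  apply/negP => mi.
  have ei : delta * price <= excess th i c by have := excess_ge th i c; rewrite mi mulr1.
  have others i' : i' != i -> #|near i' c| = target th i'.
    move=> i'i; apply: near_target (lti _) _; apply/negP => mi'.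
    move: sumlt; rewrite ltNge (bigD1 i)//= (bigD1 i')//= => /negP; apply.
    have := excess_ge th i' c; rewrite mi' mulr1 => ei'.
    rewrite -mulrA mulr2n mulrDl mul1r lerD// (le_trans ei')// lerDl.
    by apply: sumr_ge0 => i'' _; exact: excess_ge0.
  have kE := sum_target th; rewrite (bigD1 i)//= in kE.
  have nE : (\sum_i #|near i c| = #|near i c| + \sum_(i' | i' != i) target th i')%N.
    by rewrite (bigD1 i)//=; congr addn; exact: eq_bigr.
  have nt : (#|near i c| <= target th i)%N
    by rewrite -(leq_add2r (\sum_(i' | i' != i) target th i')) kE -nE.
  move: mi; rewrite /misfit; move: nt kE; rewrite /target; case: (heavy th i) => nt kE.
    rewrite eqb_id -leqNgt => n1.
    have : price <= price * (k%:R - (\sum_i #|near i c|)%N%:R).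
      rewrite -[leLHS]mulr1 ler_pM2l ?price_gt0// lerBrDr nat1r ler_nat.
      by rewrite nE (leq_trans _ (eq_leq kE))// ltn_add2r.
    move: lt; rewrite slack (bigD1 i)//=.
    have : 0 <= \sum_(i' | i' != i) excess th i' c.
      by apply: sumr_ge0 => i' _; exact: excess_ge0.
    move: ei price_gt0 dprice_le; risk_lra.
  by rewrite eqbF_neg negbK ltnNge nt.
split=> [i|]; first by split=> //; exact: near_target.
have sum_near : (\sum_i #|near i c| = k)%N.
  by rewrite -[RHS](sum_target th); apply: eq_bigr => i _; exact: near_target.
move: slack; rewrite sum_near subrr mulr0 addr0 => <-; ring.
Qed.

(** The mass that a code serves when the codes are those of [codebook th'] and the
    distribution is that of th. *)
Definition code_weight th th' q : R :=
  match q.2 with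
  | Some s => weight th (q.1, th' q.1) / 2
  | None => weight th (q.1, ~~ th' q.1)
  end.

Definition floor_risk th th' : R :=
  v + \sum_l weight th (l, ~~ th' l) * (Dl ^+ 2 / 4).

(** The risk when the code pi q is imposed on the blobs that [code_point th' q]
    serves. *)
Definition qrisk th th' (pi : 'I_j * option bool -> 'I_k) c : R :=
  floor_risk th th' +
  \sum_q code_weight th th' q * edist (code_point th' q) (tnth c (pi q)) ^+ 2.

Lemma code_weight_gt0 th th' q : 0 < code_weight th th' q.
Proof.
rewrite /code_weight; case: q.2 => [s|]; last exact: weight_gt0.
by apply: divr_gt0 => //; exact: weight_gt0.
Qed.

Lemma qriskE th th' pi c : qrisk th th' pi c = \sum_l
  (weight th (l, th' l) *
     (v + (edist (ctr (l, th' l) false) (tnth c (pi (l, Some false))) ^+ 2 +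
           edist (ctr (l, th' l) true) (tnth c (pi (l, Some true))) ^+ 2) / 2) +
   weight th (l, ~~ th' l) *
     (v + Dl ^+ 2 / 4 + edist (z (l, ~~ th' l)) (tnth c (pi (l, None))) ^+ 2)).
Proof.
have vE : v = \sum_i weight th i * v by rewrite -mulr_suml weight_sum mul1r.
rewrite /qrisk /floor_risk [X in X + _ + _]vE (sum_pair_index th') sum_code_index -!big_split/=.
by apply: eq_bigr => l _; rewrite /code_weight /code_point /=; field.
Qed.

Lemma pcost_le i c (p : bool -> 'I_k) :
  pcost i c <= v + (edist (ctr i false) (tnth c (p false)) ^+ 2 +
                    edist (ctr i true) (tnth c (p true)) ^+ 2) / 2.
Proof.
have hw : 0 < h by exact: blob_width_gt0.
have := cost_le hw (ctr i false) c (p false).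
have := cost_le hw (ctr i true) c (p true).
rewrite pcostE; metric_lra.
Qed.

Lemma pcost_le1 i c (l : 'I_k) :
  pcost i c <= v + Dl ^+ 2 / 4 + edist (z i) (tnth c l) ^+ 2.
Proof.
by rewrite -addrA -ctr_midpoint//; exact: (pcost_le i c (fun=> l)).
Qed.

Lemma prisk_le_qrisk th th' pi c : prisk th c <= qrisk th th' pi c.
Proof.
rewrite /prisk (sum_pair_index th') qriskE; apply: ler_sum => l _.
apply: lerD; rewrite ler_pM2l ?weight_gt0//; last exact: pcost_le1.
exact: (pcost_le (l, th' l) c (fun s => pi (l, Some s))).
Qed.

(** Near a codebook adapted to th', each blob lies in the cell of its code, so that
    the risk is there exactly the quadratic function. *)
Lemma prisk_served th th' pi c : (forall l, exists q, l = pi q) ->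
  (forall q, edist (code_point th' q) (tnth c (pi q)) <= Dl / 10) ->
  prisk th c = qrisk th th' pi c.
Proof.
move=> surj close; rewrite /prisk (sum_pair_index th') qriskE.
apply: eq_bigr => l _; congr (_ * _ + _ * _).
  have sv s : cost h (ctr (l, th' l) s) c =
      v + edist (ctr (l, th' l) s) (tnth c (pi (l, Some s))) ^+ 2.
    apply: blob_cost_served => // x l' xs; have [q ->] := surj l'.
    have [->//|qs] := eqVneq q (l, Some s).
    have sep : Dl <= edist (code_point th' q) (ctr (l, th' l) s) :=
      code_point_sep d_gt0 Dl_gt0 z_sep th' qs.
    have cs : edist (ctr (l, th' l) s) (tnth c (pi (l, Some s))) <= Dl / 10 :=
      close (l, Some s).
    have := close q; move: sep cs.
    have := edist_triangle (ctr (l, th' l) s) x (tnth c (pi (l, Some s))).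
    have := edist_triangle x (ctr (l, th' l) s) (tnth c (pi q)).
    have := edist_triangle (tnth c (pi q)) (ctr (l, th' l) s) (code_point th' q).
    rewrite (edistC (tnth c (pi q)) (code_point th' q)).
    rewrite (edistC (ctr (l, th' l) s) x) (edistC (code_point th' q) (ctr (l, th' l) s)).
    metric_lra.
  by rewrite pcostE !sv; field.
have sv s : cost h (ctr (l, ~~ th' l) s) c =
    v + edist (ctr (l, ~~ th' l) s) (tnth c (pi (l, None))) ^+ 2.
  apply: blob_cost_served => // x l' xs; have [q ->] := surj l'.
  have [->//|qs] := eqVneq q (l, None).
  have /(code_center_far d_gt0 Dl_gt0 z_sep) : code_center th' q != (l, ~~ th' l).
    apply: contra qs; case: q => [l'' [s'|]]; rewrite /code_center /= xpair_eqE => /andP[/eqP ->].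
      by case: (th' l).
    by rewrite eqxx.
  have cs : edist (z (l, ~~ th' l)) (tnth c (pi (l, None))) <= Dl / 10 := close (l, None).
  have := close q; move: cs.
  have := edist_triangle (ctr (l, ~~ th' l) s) x (tnth c (pi (l, None))).
  have := edist_triangle (z (l, ~~ th' l)) (ctr (l, ~~ th' l) s) (tnth c (pi (l, None))).
  have := edist_triangle x (z (l, ~~ th' l)) (tnth c (pi q)).
  have := edist_triangle (ctr (l, ~~ th' l) s) x (z (l, ~~ th' l)).
  have := edist_triangle (tnth c (pi q)) (z (l, ~~ th' l)) (code_point th' q).
  rewrite (edistC (tnth c (pi q)) (code_point th' q)) (edistC (z (l, ~~ th' l)) x).
  rewrite edist_ctr_mid//; metric_lra.
by rewrite pcostE !sv -[RHS]addrA -ctr_midpoint//; field.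
Qed.

Lemma prisk_codebook th th' : prisk th (codebook th') = floor_risk th th'.
Proof.
rewrite (prisk_served th (th' := th') (@code_index_surj j)); last first.
  by move=> q; rewrite tnth_codebook edistxx divr_ge0 ?ltW.
rewrite /qrisk big1 ?addr0// => q _.
by rewrite tnth_codebook edistxx expr0n mulr0.
Qed.

Lemma floor_risk_diag th : floor_risk th th = ropt.
Proof.
rewrite /floor_risk (eq_bigr (fun=> (1 - delta) / m * (Dl ^+ 2 / 4))); last first.
  move=> l _; rewrite /weight /tilt /heavy /=.
  by have /negbTE -> : ~~ th l != th l by case: (th l).
rewrite sumr_const card_ord -[in LHS]mulr_natl /ropt.
by congr (_ + _); field; rewrite pnatr_eq0 -lt0n.
Qed.

Definition flip (l0 : 'I_j) th : 'I_j -> bool :=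
  fun l => if l == l0 then ~~ th l else th l.

(** In the flipped couple, the light pair has two codes and the heavy pair only one:
    these are two misfits. *)
Lemma floor_risk_flip th l0 : floor_risk th (flip l0 th) = ropt + 2 * delta * price.
Proof.
rewrite -(floor_risk_diag th) /floor_risk -addrA; congr (_ + _).
rewrite (bigD1 l0)//= [in RHS](bigD1 l0)//= /flip eqxx negbK.
rewrite (eq_bigr (fun l => weight th (l, ~~ th l) * (Dl ^+ 2 / 4))); last first.
  by move=> l /negbTE ->.
rewrite addrAC; congr (_ + _).
rewrite /weight /tilt /heavy /= eqxx.
have /negbTE -> : ~~ th l0 != th l0 by case: (th l0).
by rewrite /price; field; rewrite pnatr_eq0 -lt0n.
Qed.

Lemma prisk_ge_ropt th c : ropt <= prisk th c.
Proof.
by apply: le_trans (prisk_ge th c); rewrite lerDl mulr_ge0 ?(ltW dprice_gt0).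
Qed.

Lemma prisk_codebook_local th th' c :
  (forall l, edist (tnth (codebook th') l) (tnth c l) <= Dl / 10) ->
  prisk th (codebook th') <= prisk th c.
Proof.
move=> close; rewrite prisk_codebook.
rewrite (prisk_served th (th' := th') (@code_index_surj j)); last first.
  by move=> q; rewrite -tnth_codebook.
rewrite /qrisk lerDl sumr_ge0// => q _.
by rewrite mulr_ge0 ?sqr_ge0 ?(ltW (code_weight_gt0 _ _ _)).
Qed.

(** Below the second smallest floor, the numbers of codes near each pair are
    those of an optimal codebook, and each blob is served by a single code. *)
Lemma prisk_lt_qrisk th c : prisk th c < ropt + 2 * delta * price ->
  exists2 pi, injective pi & prisk th c = qrisk th th pi c.
Proof.
move=> /prisk_lt_fit[fit priskE].
have heavyT l : heavy th (l, th l) = true by rewrite /heavy eqxx.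
have heavyF l : heavy th (l, ~~ th l) = false.
  by rewrite /heavy/=; case: (th l).
have /choice[p pP] l : exists p : option bool -> 'I_k,
   [/\ forall o, p o \in near (code_center th (l, o)) c,
       p (Some false) != p (Some true),
       excess th (l, th l) c = code_weight th th (l, Some false) *
           edist (code_point th (l, Some false)) (tnth c (p (Some false))) ^+ 2 +
         code_weight th th (l, Some true) *
           edist (code_point th (l, Some true)) (tnth c (p (Some true))) ^+ 2 &
       excess th (l, ~~ th l) c = code_weight th th (l, None) *
         edist (code_point th (l, None)) (tnth c (p None)) ^+ 2].
  have [n2 e2] := fit (l, th l); have [n1 e1] := fit (l, ~~ th l).
  move: n2 n1; rewrite /target heavyT heavyF => n2 n1.
  have [[p [pf pt pft] pE]|] := excess_near2 th n2; last first.
    by rewrite heavyT leNgt e2.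
  have [[l' l'n lE]|] := excess_near1 th n1; last by rewrite ltNge ltW.
  exists (fun o => if o is Some s then p s else l'); split=> //.
  - by case=> [[]|].
  - by rewrite pE heavyT add0r /code_weight /code_point /=; field.
  - by rewrite lE heavyF add0r.
exists (fun q => p q.1 q.2).
  move=> [l o] [l' o'] /= pp.
  have [pn _ _ _] := pP l; have [pn' _ _ _] := pP l'.
  have := near_inj Dl_gt0 z_sep (pn o); rewrite pp => /(_ _ (pn' o')).
  rewrite /code_center /= => -[ll]; rewrite -ll in pp *.
  have [_ pft _ _] := pP l.
  case: o o' pp {pn pn'} => [[]|] [[]|] //= pp; try by case: (th l).
    by move: pft; rewrite pp eqxx.
  by move: pft; rewrite pp eqxx.
rewrite priskE /qrisk floor_risk_diag; congr (_ + _).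
rewrite (sum_pair_index th) sum_code_index; apply: eq_bigr => l _.
by have [_ _ -> ->] := pP l.
Qed.

(** A quadratic function takes its minimal value only where all squares vanish. *)
Lemma prisk_ropt_codes th c : prisk th c <= ropt ->
  exists2 pi, injective pi & forall q, tnth c (pi q) = code_point th q.
Proof.
move=> c_opt; have [|pi pinj piE] := @prisk_lt_qrisk th c.
  by rewrite (le_lt_trans c_opt)// ltrDl mulr_gt0 ?price_gt0 ?mulr_gt0.
exists pi => // q.
have t0 q' : 0 <= code_weight th th q' * edist (code_point th q') (tnth c (pi q')) ^+ 2.
  by rewrite mulr_ge0 ?sqr_ge0 ?(ltW (code_weight_gt0 _ _ _)).
have : code_weight th th q * edist (code_point th q) (tnth c (pi q)) ^+ 2 <= 0.
  move: c_opt; rewrite piE /qrisk floor_risk_diag gerDl; apply: le_trans.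
  by rewrite (bigD1 q)//= lerDl sumr_ge0.
rewrite pmulr_rle0 ?code_weight_gt0// => e0; apply/esym/edist_le0.
by move: e0; rewrite exprn_even_le0//= => /eqP ->.
Qed.

Definition interp (t : R) c c' : k.-tuple (d.-tuple R) :=
  [tuple lincomb (1 - t) (tnth c l) t (tnth c' l) | l < k].

(** The quadratic function bounds the risk and equals it at c.  Moving all codes
    by a fraction t towards its minimizer multiplies the sum of squares by
    (1 - t)^2, hence lowers the risk strictly. *)
Lemma prisk_descent th c : ropt < prisk th c -> prisk th c < ropt + 2 * delta * price ->
  exists c', forall t, 0 < t <= 1 -> prisk th (interp t c c') < prisk th c.
Proof.
move=> c_gt /prisk_lt_qrisk[pi pinj piE].
have [g piK gK] : bijective pi.
  by apply: inj_card_bij => //; rewrite card_code card_ord.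
exists [tuple code_point th (g l) | l < k] => t /andP[t0 t1].
apply: le_lt_trans (prisk_le_qrisk th th pi _) _.
move: c_gt; rewrite piE /qrisk floor_risk_diag ltrDl ltrD2l.
set S := \sum_q _ => S0.
rewrite (_ : \sum_q _ = (1 - t) ^+ 2 * S).
  rewrite -[ltRHS]mul1r ltr_pM2r// expr_lt1//; lra.
rewrite /S mulr_sumr; apply: eq_bigr => q _.
rewrite (@edist_homothety _ _ (1 - t) _ _ (code_point th q) (tnth c (pi q))).
  by rewrite exprMn real_normK ?num_real//; ring.
by move=> s; rewrite !tnth_mktuple piK; ring.
Qed.

End perturbed.

(** * Testing between two distributions from a sample *)

Section ratio.
Context (disp : measure_display) (T : measurableType disp) (R : realType).
Context (I : finType).
Variables (P P' : {sigma_finite_measure set T -> \bar R}) (S : I -> set T) (r : I -> R).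
Hypotheses (mS : forall i, measurable (S i)) (r0 : forall i, 0 <= r i).
Hypothesis ratio : forall i A, measurable A ->
  P' (A `&` S i) = ((r i)%:E * P (A `&` S i))%E.

Definition box n (u : 'I_n -> I) : set (n.-tuple T) :=
  [set t | forall i, S (u i) (tnth t i)].

Lemma measurable_box n (u : 'I_n -> I) : measurable (box u).
Proof.
rewrite (_ : box u = \big[setI/setT]_(i < n)
    ((fun t : n.-tuple T => tnth t i) @^-1` S (u i))).
  apply: bigsetI_measurable => i _.
  by rewrite -[X in measurable X]setTI; exact: measurable_tnth.
rewrite -bigcap_seq; apply/seteqP; split=> t /= tu i; first by move=> _; exact: tu.
by apply: tu; rewrite /= mem_index_enum.
Qed.

Lemma integral_ratio i (g : T -> \bar R) : measurable_fun setT g ->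
  (forall x, (0 <= g x)%E) ->
  (\int[P']_(x in S i) g x = (r i)%:E * \int[P]_(x in S i) g x)%E.
Proof.
move=> mg g0; rewrite -(@ge0_integral_mscale _ _ _ P _ (mS i) (NngNum (r0 i)))//; last first.
  exact: measurable_funTS.
apply: eq_measure_integral => A mA /setIidPl AS.
by rewrite -AS /mscale /= ratio.
Qed.

(** On a box of regions the likelihood ratio of the samples is constant, so that
    testing reduces to the numbers of points in the regions. *)
Lemma tuple_measure_ratio n (u : 'I_n -> I) A : measurable A ->
  tuple_measure P' n (A `&` box u) =
  ((\prod_(i < n) r (u i))%:E * tuple_measure P n (A `&` box u))%E.
Proof.
elim: n u A => [|n IH] u A mA; first by rewrite big_ord0 mul1e.
pose B := @tuple_cons _ T n @^-1` A.
have mB : measurable B.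
  by rewrite -[B]setTI; exact: (@measurable_tuple_cons _ T n measurableT A mA).
pose u' := fun i => u (lift ord0 i).
have tmE (mu : {sigma_finite_measure set T -> \bar R}) :
    tuple_measure mu n.+1 (A `&` box u) =
    (\int[mu]_(x in S (u ord0)) tuple_measure mu n (xsection B x `&` box u'))%E.
  rewrite /= /cons_measure /pushforward /product_measure1 [RHS]integral_mkcond.
  apply: eq_integral => x _; rewrite patchE /=; case: ifPn => [|/negP]; rewrite inE => Sx.
    congr (tuple_measure mu n _); apply/seteqP; split=> t; rewrite /xsection /= !inE.
      move=> [At tu]; split=> // i.
      by have := tu (lift ord0 i); rewrite tnthS.
    move=> [At tu]; split=> // i.
    by case: (unliftP ord0 i) => [l|] ->; rewrite ?tnthS//; exact: tu.
  rewrite -[RHS](measure0 (tuple_measure mu n)); congr (tuple_measure mu n _).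
  rewrite -subset0 => t; rewrite /xsection /= inE => -[_ tu].
  by apply: Sx; exact: (tu ord0).
rewrite !tmE big_ord_recl EFinM.
have xsE x : xsection B x `&` box u' = xsection (B `&` ([set: T] `*` box u')) x.
  by apply/seteqP; split=> t; rewrite /xsection /= !inE => -[Bt ut]; split=> //; case: ut.
have mC : measurable (B `&` ([set: T] `*` box u')).
  by apply: measurableI => //; apply: measurableX => //; exact: measurable_box.
have mg : measurable_fun setT (fun x => tuple_measure P n (xsection B x `&` box u')).
  under eq_fun do rewrite xsE.
  exact: (measurable_fun_xsection (tuple_measure P n) mC).
have IHx x : tuple_measure P' n (xsection B x `&` box u') =
    ((\prod_(i < n) r (u' i))%:E * tuple_measure P n (xsection B x `&` box u'))%E.
  by rewrite IH//; exact: measurable_xsection.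
under eq_integral do rewrite IHx.
rewrite ge0_integralZl//; last 2 first.
- exact: measurable_funTS.
- by rewrite lee_fin prodr_ge0.
rewrite integral_ratio// muleA; congr (_ * _)%E.
by rewrite -!EFinM mulrC.
Qed.

End ratio.

Lemma sum_measure_disjoint_le (disp : measure_display) (T : measurableType disp)
    (R : realType) (J : finType) (mu : {measure set T -> \bar R}) (F : J -> set T)
    (A : set T) : measurable A -> (forall q, measurable (F q)) ->
  (forall q, F q `<=` A) -> (forall q q' x, F q x -> F q' x -> q = q') ->
  (\sum_q mu (F q) <= mu A)%E.
Proof.
move=> mA mF FA disj.
under eq_bigr do rewrite -[F _]setIT -integral_indic//.
rewrite -ge0_integral_sum//; last first.
  by move=> q; apply/measurable_EFinP; exact: measurable_indic.
rewrite -[X in (_ <= mu X)%E]setIT -integral_indic//; apply: ge0_le_integral_nonmeas => x.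
  by apply: sume_ge0 => q _; rewrite lee_fin.
rewrite sumEFin lee_fin; case: (pselect (exists q, F q x)) => [[q Fq]|no].
  rewrite (bigD1 q)//= big1 ?addr0 => [|q' q'q].
    by rewrite !indicE !mem_set//; exact: FA Fq.
  rewrite indicE memNset// => Fq'; move/eqP: q'q; apply.
  exact: disj Fq' Fq.
rewrite big1// => q _; rewrite indicE memNset// => Fq; apply: no; by exists q.
Qed.

Lemma bernoulli_ineq (R : realDomainType) (x : R) n : 0 <= x <= 1 ->
  1 - n%:R * x <= (1 - x) ^+ n.
Proof.
move=> /andP[x0 x1]; elim: n => [|n IH]; first by rewrite mul0r subr0.
rewrite exprSr; apply: (@le_trans _ _ ((1 - n%:R * x) * (1 - x))).
  rewrite -natr1 -subr_ge0.
  have -> : (1 - n%:R * x) * (1 - x) - (1 - (n%:R + 1) * x) = n%:R * (x * x) by ring.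
  by rewrite !mulr_ge0.
by apply: ler_wpM2r => //; rewrite subr_ge0.
Qed.

(** The overlap of two product weights is bounded below through their affinity.
    The geometric mean of two numbers is at most 2 min + max/8, which is
    (a + b)/8 + 15/8 min; the total affinity is at least 1/2 by Bernoulli's
    inequality, hence 1/2 <= 1/4 + 15/8 sum min. *)
Lemma overlap_product (R : realFieldType) (I : finType) (w w' g : I -> R) n :
  (forall i, 0 <= w i) -> (forall i, 0 <= w' i) -> (forall i, 0 <= g i) ->
  \sum_i w i = 1 -> \sum_i w' i = 1 -> (forall i, g i ^+ 2 <= w i * w' i) ->
  \sum_i g i <= 1 -> 2 * n%:R * (1 - \sum_i g i) <= 1 ->
  8^-1 <= \sum_(u : {ffun 'I_n -> I})
     Num.min (\prod_(l < n) w (u l)) (\prod_(l < n) w' (u l)).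
Proof.
move=> w0 w'0 g0 w1 w'1 gww' g1 ng.
have powsum (f : I -> R) : \sum_(u : {ffun 'I_n -> I}) \prod_(l < n) f (u l) = (\sum_i f i) ^+ n.
  by rewrite -(bigA_distr_bigA (fun (_ : 'I_n) i => f i)) prodr_const card_ord.
have gn : 1 / 2 <= (\sum_i g i) ^+ n.
  have := @bernoulli_ineq R (1 - \sum_i g i) n.
  rewrite subKr subr_ge0 g1 gerBl sumr_ge0// => /(_ isT).
  by apply: le_trans; lra.
rewrite -powsum in gn.
pose mn u := Num.min (\prod_(l < n) w (u l)) (\prod_(l < n) w' (u l)).
have gm (u : {ffun 'I_n -> I}) : \prod_(l < n) g (u l) <=
    (\prod_(l < n) w (u l) + \prod_(l < n) w' (u l)) / 8 + 15 / 8 * mn u.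
  have G0 : 0 <= \prod_(l < n) g (u l) by exact: prodr_ge0.
  have W0 : 0 <= \prod_(l < n) w (u l) by exact: prodr_ge0.
  have W'0 : 0 <= \prod_(l < n) w' (u l) by exact: prodr_ge0.
  have GW : (\prod_(l < n) g (u l)) ^+ 2 <= \prod_(l < n) w (u l) * \prod_(l < n) w' (u l).
    rewrite -prodrXl -big_split/=; apply: ler_prod => l _.
    by rewrite sqr_ge0 gww'.
  rewrite /mn; move: G0 W0 W'0 GW.
  move: (\prod_(l < n) g _) (\prod_(l < n) w _) (\prod_(l < n) w' _) => G a b G0 a0 b0 Gab.
  wlog ab : a b a0 b0 Gab / a <= b.
    move=> H; have [ab|ba] := lerP a b.
      by have := H a b a0 b0 Gab ab; rewrite min_l.
    have := H b a b0 a0; rewrite mulrC => /(_ Gab (ltW ba)).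
    by rewrite min_l ?(ltW ba)// [b + a]addrC.
  rewrite min_l//; have p0 : 0 <= 2 * a + b / 8 by lra.
  have : G <= 2 * a + b / 8.
    rewrite -(ler_pXn2r (isT : (0 < 2)%N) G0 p0); apply: (le_trans Gab).
    by have := sqr_ge0 (2 * a - b / 8); rewrite sqrrB sqrrD; lra.
  lra.
have : \sum_(u : {ffun 'I_n -> I}) \prod_(l < n) g (u l) <=
    \sum_(u : {ffun 'I_n -> I}) ((\prod_(l < n) w (u l) + \prod_(l < n) w' (u l)) / 8
      + 15 / 8 * mn u) by exact: ler_sum.
rewrite big_split/= -mulr_suml -mulr_sumr big_split/= !powsum w1 w'1 expr1n.
rewrite -powsum /mn; move: gn.
set x := \sum_u _; set y := \sum_u _; lra.
Qed.

Section two_point.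
Context (disp : measure_display) (T : measurableType disp) (R : realType).
Context (I : finType).
Variables (P P' : probability T R) (S : I -> set T) (w w' g : I -> R) (n : nat).
Hypotheses (mS : forall i, measurable (S i))
  (disj : forall i i' x, S i x -> S i' x -> i = i').
Hypotheses (w0 : forall i, 0 < w i) (w'0 : forall i, 0 <= w' i) (g0 : forall i, 0 <= g i).
Hypotheses (w1 : \sum_i w i = 1) (w'1 : \sum_i w' i = 1).
Hypotheses (gww' : forall i, g i ^+ 2 <= w i * w' i) (g1 : \sum_i g i <= 1).
Hypothesis ng : 2 * n%:R * (1 - \sum_i g i) <= 1.
Hypothesis PS : forall i, ((w i)%:E <= P (S i))%E.
Hypothesis ratio : forall i A, measurable A ->
  P' (A `&` S i) = ((w' i / w i)%:E * P (A `&` S i))%E.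

Local Notation Pn := (tuple_measure P n).
Local Notation Pn' := (tuple_measure P' n).

(** On each box of regions, the two errors of a test add up to at least the smaller
    of the two probabilities of the box. *)
Lemma two_point_testing A : measurable A ->
  ((8^-1)%:E <= Pn (~` A) + Pn' A)%E.
Proof.
move=> mA; have r0 i : 0 <= w' i / w i by rewrite divr_ge0 ?(ltW (w0 i)).
have sumle (mu : {sigma_finite_measure set (n.-tuple T) -> \bar R}) B : measurable B ->
    (\sum_(u : {ffun 'I_n -> I}) mu (B `&` box S u) <= mu B)%E.
  move=> mB; apply: sum_measure_disjoint_le => //.
  - by move=> u; apply: measurableI => //; exact: measurable_box.
  - move=> u u' t [_ tu] [_ tu']; apply/ffunP => l; exact: disj (tu l) (tu' l).
apply: (@le_trans _ _ (\sum_(u : {ffun 'I_n -> I}) (Num.min (\prod_(l < n) w (u l))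
     (\prod_(l < n) w' (u l)))%:E)%E).
  rewrite sumEFin lee_fin; apply: overlap_product g1 ng => // i; exact: ltW.
apply: (@le_trans _ _ (\sum_(u : {ffun 'I_n -> I})
    (Pn (~` A `&` box S u) + Pn' (A `&` box S u)))%E); last first.
  rewrite big_split/=; apply: leeD; apply: sumle => //; exact: measurableC.
apply: lee_sum => u _.
rewrite (tuple_measure_ratio mS r0 ratio)//.
set q := \prod_(l < n) (w' (u l) / w (u l)).
have q0 : 0 <= q by apply: prodr_ge0.
have wq : \prod_(l < n) w' (u l) = \prod_(l < n) w (u l) * q.
  by rewrite -big_split/=; apply: eq_bigr => l _; rewrite mulrCA divff ?mulr1 ?gt_eqF.
have W0 : 0 <= \prod_(l < n) w (u l) by apply: prodr_ge0 => l _; exact: ltW.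
have boxE : ((\prod_(l < n) w (u l))%:E <= Pn (~` A `&` box S u) + Pn (A `&` box S u))%E.
  have -> : (Pn (~` A `&` box S u) + Pn (A `&` box S u) = Pn (box S u))%E.
    rewrite setIC -setDE (setIC A); apply/esym.
    by apply: (measureDI Pn) => //; exact: measurable_box.
  have -> : Pn (box S u) = (\prod_(l < n) P (S (u l)))%E.
    exact: (tuple_measure_box P (A := fun l => S (u l))).
  have PE i : P (S i) = (fine (P (S i)))%:E by rewrite fineK// fin_num_measure.
  rewrite (eq_bigr _ (fun l _ => PE (u l))) prodEFin lee_fin; apply: ler_prod => l _.
  by rewrite ltW//= -lee_fin -PE.
pose mq := Num.min 1 q.
have mq0 : 0 <= mq by rewrite le_min ler01.
apply: (@le_trans _ _ (mq%:E * (Pn (~` A `&` box S u) + Pn (A `&` box S u)))%E).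
  apply: le_trans (lee_wpmul2l _ boxE); last by rewrite lee_fin.
  by rewrite -EFinM lee_fin wq -[X in Num.min X _]mulr1 -minr_pMr// mulrC.
rewrite ge0_muleDr//; apply: leeD.
  by rewrite -[leRHS]mul1e lee_wpmul2r// lee_fin ge_min lexx.
by rewrite lee_wpmul2r// lee_fin ge_min lexx orbT.
Qed.

End two_point.

(** * Neighbourhoods of a codebook *)

Section tuple_topology.

Lemma tuple_continuous (X T : topologicalType) n (f : X -> n.-tuple T) :
  (forall i, continuous (fun x => tnth (f x) i)) -> continuous f.
Proof.
move=> cf; apply: continuous_comp_initial => x.
apply/cvg_sup => i; move: x; apply: (@continuous_comp_initial _ _ _
  (fun u : prod_topology (fun _ : 'I_n => T) => u i)).
exact: cf.
Qed.

Context (R : realType) (d k : nat).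
Implicit Types (c : k.-tuple (d.-tuple R)).

Lemma near_codebook c (e : R) : 0 < e ->
  \forall c' \near c, forall l, edist (tnth c l) (tnth c' l) <= e.
Proof.
move=> e0; have ed : 0 < e / d.+1%:R by rewrite divr_gt0.
have near_ls (ls : 'I_k * 'I_d) : \forall c' \near c,
    `|tnth (tnth c ls.1) ls.2 - tnth (tnth c' ls.1) ls.2| < e / d.+1%:R.
  have cts : {for c, continuous (fun c' : k.-tuple (d.-tuple R) => tnth (tnth c' ls.1) ls.2)}.
    apply: (@continuous_comp _ _ _ (fun c' : k.-tuple (d.-tuple R) => tnth c' ls.1)
      (fun x : d.-tuple R => tnth x ls.2)); exact: tuple_tnth_continuous.
  by have /cvgrPdist_lt /(_ _ ed) := cts.
have FF : Filter (nbhs c) by apply: nbhs_filter.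
pose F (ls : 'I_k * 'I_d) := [set c' : k.-tuple (d.-tuple R) |
  `|tnth (tnth c ls.1) ls.2 - tnth (tnth c' ls.1) ls.2| < e / d.+1%:R].
apply: (@filterS _ _ FF _ _ _ (@filter_forall _ _ F _ FF near_ls)) => c' H l.
apply: (@le_trans _ _ (d%:R * (e / d.+1%:R))).
  apply: edist_le_coord; first exact: ltW.
  by move=> s; apply: ltW; exact: (H (l, s)).
by rewrite mulrCA ler_piMr ?(ltW e0)// ler_pdivrMr ?ltr0n// mul1r ler_nat.
Qed.

Lemma near_interp c c1 (P : k.-tuple (d.-tuple R) -> Prop) :
  (\forall c' \near c, P c') ->
  exists2 t : R, 0 < t <= 1 & P [tuple lincomb (1 - t) (tnth c l) t (tnth c1 l) | l < k].
Proof.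
pose f (t : R) : k.-tuple (d.-tuple R) :=
  [tuple lincomb (1 - t) (tnth c l) t (tnth c1 l) | l < k].
have f0 : f 0 = c.
  apply: eq_from_tnth => l; apply: eq_from_tnth => s.
  by rewrite !tnth_mktuple subr0 mul1r mul0r addr0.
have cf : continuous f.
  apply: tuple_continuous => l; apply: tuple_continuous => s.
  pose p : {poly R} := (1 - 'X) * (tnth (tnth c l) s)%:P + 'X * (tnth (tnth c1 l) s)%:P.
  suff: continuous (fun t : R => tnth (tnth (f t) l) s) by [].
  have -> : (fun t : R => tnth (tnth (f t) l) s) = horner p.
    by apply/funext => t; rewrite !tnth_mktuple /p !hornerE.
  by apply: continuous_horner.
rewrite -{1}f0 => Pf0; have : \forall t \near (0 : R), P (f t) by exact: (cf 0 _ Pf0).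
move=> /nbhs_ballP[e /= e0 eP]; exists (Num.min (e / 2) 1).
  by rewrite lt_min divr_gt0//= ltr01 ge_min lexx orbT.
apply: eP; rewrite /ball/= sub0r normrN ger0_norm.
  by rewrite gt_min ltr_pdivrMr// ltr_pMr// ltr1n.
by rewrite le_min ler01 divr_ge0// ltW.
Qed.

End tuple_topology.

(** * The class of distributions *)

Section model.
Context (R : realType) (d j : nat) (M Dl delta : R) (z : 'I_j * bool -> d.-tuple R).
Hypotheses (d_gt0 : (0 < d)%N) (j_gt0 : (0 < j)%N) (Dl_gt0 : 0 < Dl).
Hypothesis z_sep : forall i i', i != i' -> 5 * Dl <= edist (z i) (z i').
Hypotheses (delta_gt0 : 0 < delta) (delta_le : delta <= 1 / 3).
Hypothesis z_ball : forall i, edist (origin R d) (z i) <= 25 / 32 * M.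
Hypothesis Dl_le : Dl <= 5 / 32 * M.

Local Notation k := (j * 3)%N.
Local Notation h := (blob_width d Dl).
Local Notation ctr := (ctr Dl z).
Local Notation weight := (weight delta).
Local Notation prisk := (prisk Dl delta z).
Local Notation ropt := (ropt d Dl delta).
Local Notation price := (price j Dl).
Local Notation codebook := (codebook Dl z).
Local Notation code_point := (code_point Dl z).

Implicit Types (th : 'I_j -> bool) (i : 'I_j * bool) (c : k.-tuple (d.-tuple R)).

Let k_gt0 : (0 < k)%N. Proof. by rewrite muln_gt0 j_gt0. Qed.

Let h_gt0 : 0 < h. Proof. exact: blob_width_gt0. Qed.

Definition blob_center (q : ('I_j * bool) * bool) : d.-tuple R := ctr q.1 q.2.

Definition blob_weight th (q : ('I_j * bool) * bool) : R := weight th q.1 / 2.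

Lemma blob_weight_ge0 th q : 0 <= blob_weight th q.
Proof. by apply: divr_ge0 => //; apply: ltW; exact: weight_gt0. Qed.

Lemma sum_blob_index (V : nmodType) (F : ('I_j * bool) * bool -> V) :
  \sum_q F q = \sum_i (F (i, false) + F (i, true)).
Proof.
rewrite (eq_bigr (fun q => F (q.1, q.2))); last by case.
rewrite -(pair_bigA _ (fun i s => F (i, s)))/=; apply: eq_bigr => i _.
by rewrite big_bool addrC.
Qed.

Lemma blob_weight_sum th : \sum_q blob_weight th q = 1.
Proof.
rewrite -(weight_sum delta j_gt0 th) sum_blob_index; apply: eq_bigr => i _.
by rewrite /blob_weight -splitr.
Qed.

Definition model th : probability (d.-tuple R) R :=
  mixture_prob blob_center h_gt0 (blob_weight_ge0 th) (blob_weight_sum th).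

Lemma risk_model th c : risk (model th) c = (prisk th c)%:E.
Proof.
rewrite risk_mixture// sum_blob_index; congr (_%:E); apply: eq_bigr => i _.
by rewrite /blob_weight /blob_center /pcost /=; field.
Qed.

Lemma risk_codebook th : risk (model th) (codebook th) = ropt%:E.
Proof. by rewrite risk_model prisk_codebook// floor_risk_diag. Qed.

Lemma optimal_model th c : optimal (model th) c <-> prisk th c <= ropt.
Proof.
split=> [/(_ (codebook th))|co c']; first by rewrite risk_codebook risk_model lee_fin.
rewrite !risk_model lee_fin (le_trans co)//; exact: prisk_ge_ropt.
Qed.

Lemma optimal_codebook th : optimal (model th) (codebook th).
Proof. by apply/optimal_model; rewrite prisk_codebook// floor_risk_diag. Qed.

Lemma optimal_codes th c : optimal (model th) c ->
  exists2 pi : 'I_j * option bool -> 'I_k, bijective pi &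
    forall q, tnth c (pi q) = code_point th q.
Proof.
move=> /optimal_model /(prisk_ropt_codes d_gt0 j_gt0 Dl_gt0 z_sep delta_gt0 delta_le).
move=> [pi pinj piE]; exists pi => //; apply: inj_card_bij => //.
by rewrite card_code card_ord.
Qed.

Lemma model_unique_optimal th : unique_optimal k (model th).
Proof.
exists (codebook th) => [|c /optimal_codes[pi [g piK gK] piE]].
  exact: optimal_codebook.
rewrite perm_sym -[X in perm_eq X _]map_tnth_enum -[X in perm_eq _ X]map_tnth_enum.
have -> : [seq tnth (codebook th) l | l <- enum 'I_k] =
    [seq tnth c l | l <- [seq pi (index_code l) | l <- enum 'I_k]].
  by rewrite -map_comp; apply: eq_map => l /=; rewrite piE tnth_mktuple.
apply: perm_map; apply: uniq_perm; rewrite ?enum_uniq//.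
  rewrite map_inj_uniq ?enum_uniq// => l l' e.
  exact: (can_inj (@index_codeK j)) (can_inj piK e).
move=> l; rewrite mem_enum; apply/mapP; exists (code_index (g l)).
  by rewrite mem_enum.
by rewrite code_indexK gK.
Qed.

Definition serving th i (s : bool) : 'I_j * option bool :=
  (i.1, if heavy th i then Some s else None).

(** A code is strictly the nearest one up to distance Delta/2 of the blobs it
    serves, the blobs having radius Delta/100.  All the geometric requirements of
    the class follow from this. *)
Lemma serving_nearest th i s x q : edist x (ctr i s) < Dl / 2 ->
  q != serving th i s ->
  edist x (code_point th (serving th i s)) < edist x (code_point th q).
Proof.
move=> xs qs; case: (boolP (heavy th i)) => hi.
  have ce : code_point th (serving th i s) = ctr i s.
    rewrite /code_point /serving hi /=; congr ctr.
    by move: hi; rewrite /heavy => /eqP <-; case: (i).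
  have := code_point_sep d_gt0 Dl_gt0 z_sep th qs; rewrite ce.
  have := edist_triangle x (code_point th q) (ctr i s).
  by rewrite (edistC (code_point th q) x); move: xs; metric_lra.
have iE : i = (i.1, ~~ th i.1).
  by move: hi; rewrite /heavy; case: (i) => l s' /=; case: s' (th l) => -[].
have ce : code_point th (serving th i s) = z i.
  by rewrite /code_point /serving (negbTE hi) /= -iE.
have far : code_center th q != i.
  apply: contra qs; rewrite /serving (negbTE hi) /code_center.
  case: q => l [s'|] /=; rewrite iE /= => /eqP[->]//.
  by case: (th i.1).
have := code_center_far d_gt0 Dl_gt0 z_sep far; rewrite ce.
have := edist_triangle x (z i) (code_point th q).
have := edist_triangle (ctr i s) x (z i).
rewrite edist_ctr_mid// (edistC (z i) x); move: xs; metric_lra.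
Qed.

Lemma model_B th : B_of k (model th) = Dl%:E.
Proof.
apply/eqP; rewrite eq_le; apply/andP; split.
  apply: ereal_inf_lbound; pose l0 := Ordinal j_gt0.
  exists (codebook th), (code_index (l0, Some false)), (code_index (l0, Some true)).
  split; [exact: optimal_codebook|by rewrite (can_eq (@code_indexK j))|].
  by rewrite !tnth_codebook /code_point /= edist_ctr.
apply: le_ereal_inf_tmp => _ [c [l [l' [/optimal_codes[pi [g piK gK] piE] ll' ->]]]].
rewrite lee_fin -[l]gK -[l']gK !piE.
by apply: code_point_sep => //; rewrite (can_eq gK).
Qed.

(** The cell of a code on a heavy pair contains a blob of mass (1 + delta)/(2m) and
    that of a code on a light pair two blobs of total mass (1 - delta)/m >= 2/(3m);
    both are at least 1/(2m) = 3/(4k). *)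
Lemma model_pmin th : ((3 / (4 * k%:R))%:E <= pmin_of k (model th))%E.
Proof.
apply: le_ereal_inf_tmp => _ [c [l [/optimal_codes[pi [g piK gK] piE] ->]]].
have jR : 0 < j%:R :> R by rewrite ltr0n.
have kE : 3 / (4 * k%:R) = 1 / (4 * j%:R) :> R.
  by rewrite natrM; field; rewrite gt_eqF.
pose Q (q : ('I_j * bool) * bool) := g l == serving th q.1 q.2.
have QV q x : Q q -> edist x (blob_center q) <= d%:R * h -> voronoi c l x.
  move=> /eqP gl xq l' l'l; rewrite -[l]gK -[l']gK !piE gl; apply/ltW/serving_nearest.
    apply: le_lt_trans xq _; rewrite blob_radius//; move: Dl_gt0; lra.
  by rewrite -gl (can_eq gK).
have := le_mixture_prob h_gt0 (blob_weight_ge0 th) (blob_weight_sum th) QV.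
apply: le_trans; rewrite lee_fin kE.
case gE : (g l) => [r [s|]].
  have Qr : Q ((r, th r), s) by rewrite /Q gE /serving /heavy /= eqxx.
  rewrite (bigD1 _ Qr) /=; apply: ler_wpDr; first by apply: sumr_ge0 => q _; exact: blob_weight_ge0.
  rewrite /blob_weight !weightE /tilt /heavy /= eqxx -mulrA -invfM.
  rewrite (_ : j%:R * 2 * 2 = 4 * j%:R); last by ring.
  by rewrite ler_pM2r ?invr_gt0 ?mulr_gt0//; move: delta_gt0; lra.
have Qr s : Q ((r, ~~ th r), s).
  by rewrite /Q gE /serving /heavy /=; case: (th r).
rewrite (bigD1 _ (Qr false)) (bigD1 (r, ~~ th r, true)); last first.
  by rewrite (Qr true) xpair_eqE andbF.
rewrite /= addrA; apply: ler_wpDr; first by apply: sumr_ge0 => q _; exact: blob_weight_ge0.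
rewrite /blob_weight !weightE /tilt /heavy /=.
have /negbTE -> : ~~ th r != th r by case: (th r).
rewrite -splitr (_ : 1 / (4 * j%:R) = (1 / 2) / (j%:R * 2)); last first.
  by field; rewrite gt_eqF.
by rewrite ler_pM2r ?invr_gt0 ?mulr_gt0//; move: delta_le; lra.
Qed.

(** A point on the boundary of two cells is at distance at least Delta/2 of every
    blob centre, and 1/2 - 1/100 > 7/16. *)
Lemma model_boundary th (t : R) : t <= 7 * Dl / 16 ->
  (boundary_mass k (model th) t <= 0)%E.
Proof.
move=> t_le; apply: ge_ereal_sup => _ [c /optimal_codes[pi [g piK gK] piE] <-].
rewrite mixture_prob_eq0// => -[i s] x [a [l [l' [ll' al al']]] ax].
rewrite blob_radius// ltNge; apply/negP => xi.
have ai : edist a (ctr i s) < Dl / 2.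
  have := edist_triangle x a (ctr i s); rewrite /eball /= in ax.
  by move: xi ax t_le Dl_gt0; rewrite /blob_center /=; metric_lra.
have near l1 : voronoi c l1 a -> l1 = pi (serving th i s).
  move=> al1; apply/eqP; apply: contraT => l1s.
  have := al1 (pi (serving th i s)); rewrite eq_sym => /(_ l1s).
  rewrite -[l1]gK !piE leNgt serving_nearest//.
  by apply: contra l1s => /eqP <-; rewrite gK.
by move: ll'; rewrite (near _ al) (near _ al') eqxx.
Qed.

(** The blobs lie within (25/32 + 5/64 + 5/3200) M < M of the origin. *)
Lemma model_bounded th : bounded_distribution (model th) M.
Proof.
move=> x sx; rewrite /eball /= leNgt; apply/negP => xM'.
have {xM'}xM : M < edist (origin R d) x := xM'.
have [r r0 rE] : exists2 r, 0 < r & r = (edist (origin R d) x - M) / 2.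
  by exists ((edist (origin R d) x - M) / 2); rewrite // divr_gt0// subr_gt0.
have := sx r r0; rewrite mixture_prob_eq0 ?ltxx// => -[i s] y; rewrite /eball/= => xy.
rewrite blob_radius// ltNge; apply/negP => yi.
have := edist_triangle y (origin R d) x.
have := edist_triangle (z i) (origin R d) y.
have := edist_triangle (ctr i s) (z i) y.
have := z_ball i; have := edist_ctr_mid z d_gt0 Dl_gt0 i s.
move: yi; rewrite /blob_center /= (edistC (z i) (ctr i s)) (edistC (ctr i s) y) (edistC y x).
move: xy xM Dl_le Dl_gt0; rewrite rE; metric_lra.
Qed.

(** A local minimizer below the level of the flipped codebooks cannot be moved
    towards a lower risk, hence is optimal. *)
Lemma model_local_minimizer th c : local_minimizer (model th) c ->
  ~ optimal (model th) c -> ropt + 2 * delta * price <= prisk th c.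
Proof.
move=> cloc cnopt; rewrite leNgt; apply/negP => clt.
have cgt : ropt < prisk th c by rewrite ltNge; apply/negP => /optimal_model.
have [c1 c1P] := prisk_descent d_gt0 j_gt0 Dl_gt0 z_sep delta_gt0 delta_le cgt clt.
have [t t01 tP] := near_interp c1 cloc.
by move: tP; rewrite !risk_model lee_fin leNgt => /negP; apply; exact: c1P.
Qed.

Lemma model_separated th : separated k (model th) (2 * delta * price).
Proof.
exists (codebook th); first exact: optimal_codebook.
have lossE c : loss (model th) c (codebook th) = (prisk th c - ropt)%:E.
  by rewrite /loss risk_codebook risk_model EFinB.
apply/eqP; rewrite eq_le; apply/andP; split; last first.
  apply: le_ereal_inf_tmp => _ [c [cloc cnopt] <-].
  by rewrite lossE lee_fin lerBrDl model_local_minimizer.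
pose th' := flip (Ordinal j_gt0) th.
have c'E : prisk th (codebook th') = ropt + 2 * delta * price.
  by rewrite prisk_codebook// floor_risk_flip.
apply: ereal_inf_lbound; exists (codebook th'); last by rewrite lossE c'E addrAC subrr add0r.
split.
  have Dl10 : 0 < Dl / 10 by rewrite divr_gt0.
  have := near_codebook (codebook th') Dl10; rewrite /local_minimizer /=.
  have FF : Filter (nbhs (codebook th')) by apply: nbhs_filter.
  apply: (@filterS _ _ FF) => c close; rewrite !risk_model lee_fin.
  exact: (prisk_codebook_local d_gt0 j_gt0 Dl_gt0 z_sep delta_gt0 delta_le).
move/optimal_model; rewrite c'E gerDl leNgt mulr_gt0 ?price_gt0//.
by rewrite mulr_gt0.
Qed.

Lemma model_class_D th : Delta d k M = Dl ->
  class_D k M (2 * delta * price) (model th).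
Proof.
move=> DlE; split.
- exact: model_separated.
- exact: mixture_has_continuous_density.
- exact: model_unique_optimal.
- split=> [|t /andP[t0 t_le]]; first exact: model_bounded.
  apply: le_trans (model_boundary th _) _; first by rewrite -DlE.
  have pmin0 : (0 <= pmin_of k (model th))%E.
    by apply: le_trans (model_pmin th); rewrite lee_fin divr_ge0// mulr_ge0.
  rewrite model_B !mule_ge0// lee_fin ?(ltW Dl_gt0)//.
  by rewrite divr_ge0// mulr_ge0// sqr_ge0.
- by rewrite model_B DlE; split=> //; exact: model_pmin.
Qed.

End model.

(** * Averaging over the sign vectors *)

Section assouad.
Context (R : realType) (d j n : nat) (Dl delta : R) (z : 'I_j * bool -> d.-tuple R).
Hypotheses (d_gt0 : (0 < d)%N) (j_gt0 : (0 < j)%N) (Dl_gt0 : 0 < Dl).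
Hypothesis z_sep : forall i i', i != i' -> 5 * Dl <= edist (z i) (z i').
Hypotheses (delta_gt0 : 0 < delta) (delta_le : delta <= 1 / 3).
Hypothesis delta_n : 4 * n%:R * delta ^+ 2 <= j%:R * 2.

Local Notation k := (j * 3)%N.
Local Notation h := (blob_width d Dl).
Local Notation ctr := (ctr Dl z).
Local Notation weight := (weight delta).
Local Notation prisk := (prisk Dl delta z).
Local Notation ropt := (ropt d Dl delta).
Local Notation price := (price j Dl).
Local Notation codebook := (codebook Dl z).
Local Notation model := (model z d_gt0 j_gt0 Dl_gt0 delta_gt0 delta_le).

Implicit Types (th : 'I_j -> bool) (i : 'I_j * bool) (c : k.-tuple (d.-tuple R)).

(** The regions are disjoint, carry all the mass and each contains one pair, so that
    any two of the distributions are proportional on each of them. *)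
Definition region i : set (d.-tuple R) := [set x | edist x (z i) <= Dl].

Lemma measurable_edist_le (r : R) (a : d.-tuple R) : 0 <= r ->
  measurable [set x : d.-tuple R | edist x a <= r].
Proof.
move=> r0; have -> : [set x : d.-tuple R | edist x a <= r] =
    [set: d.-tuple R] `&` (fun x => edist x a ^+ 2) @^-1` `]-oo, r ^+ 2].
  rewrite setTI; apply/seteqP; split => x /=; rewrite in_itv/= ler_pXn2r ?nnegrE ?edist_ge0//.
exact: measurable_edist_sqr.
Qed.

Lemma region_inj i i' x : region i x -> region i' x -> i = i'.
Proof.
rewrite /region /= => xi xi'; apply/eqP; apply: contraT => /z_sep.
have := edist_triangle x (z i) (z i'); rewrite (edistC (z i) x).
metric_lra.
Qed.

Lemma mixture_region th i x : region i x ->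
  mixture h (blob_center Dl z) (blob_weight delta th) x =
  weight th i * ((blob h (ctr i false) x + blob h (ctr i true) x) / 2).
Proof.
move=> xi; have h0 : 0 < h by exact: blob_width_gt0.
rewrite /mixture sum_blob_index (bigD1 i)//= big1 ?addr0 => [|i' i'i].
  by rewrite /blob_weight /blob_center /=; field.
have far s : blob h (ctr i' s) x = 0.
  apply: blob_eq0 => //; rewrite blob_radius// ltNge; apply/negP => xs.
  have := z_sep i'i; have := edist_triangle x (z i') (z i).
  have := edist_triangle (ctr i' s) (z i') x; rewrite (edistC (z i') (ctr i' s)).
  rewrite edist_ctr_mid// (edistC (ctr i' s) x); move: xi xs; rewrite /region /=.
  clear h0; metric_lra.
by rewrite /blob_center /= !far !mulr0 addr0.
Qed.

Lemma model_region_ratio th th' i A : measurable A ->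
  model th' (A `&` region i) =
  ((weight th' i / weight th i)%:E * model th (A `&` region i))%E.
Proof.
move=> mA; have h0 : 0 < h by exact: blob_width_gt0.
have w0 : 0 < weight th i by exact: weight_gt0.
have mI : measurable (A `&` region i).
  by apply: measurableI => //; apply: measurable_edist_le; exact: ltW.
rewrite !mixture_probE -ge0_integralZl//.
- apply: eq_integral => x /[1!inE] -[_ xi]; rewrite -EFinM !(mixture_region _ xi).
  by congr (_%:E); field; rewrite gt_eqF.
- by apply/measurable_funTS/measurable_EFinP; exact: measurable_mixture.
- by move=> x _; rewrite lee_fin mixture_ge0//; exact: blob_weight_ge0.
- by rewrite lee_fin divr_ge0 ?(ltW w0)// ltW// weight_gt0.
Qed.

Lemma le_model_region th i : ((weight th i)%:E <= model th (region i))%E.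
Proof.
have h0 : 0 < h by exact: blob_width_gt0.
have sub (q : ('I_j * bool) * bool) x : q.1 == i ->
    edist x (blob_center Dl z q) <= d%:R * h -> region i x.
  case: q => [i' s] /= /eqP ->; rewrite blob_radius// => xs; rewrite /region /=.
  have := edist_triangle (ctr i s) x (z i); rewrite edist_ctr_mid//.
  by move: xs; rewrite /blob_center /=; clear h0; metric_lra.
have := le_mixture_prob h0 (blob_weight_ge0 j_gt0 delta_gt0 delta_le th)
  (blob_weight_sum delta j_gt0 th) sub.
apply: le_trans; rewrite lee_fin big_mkcond sum_blob_index (bigD1 i)//= eqxx.
rewrite big1 => [|i' /negbTE -> //]; last by rewrite addr0.
by rewrite addr0 /blob_weight -splitr.
Qed.

(** The distributions of th and of th flipped at l differ only on the two pairs of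
    couple l, where the geometric mean of the masses (1 + delta)/m and
    (1 - delta)/m is at least (1 - delta^2)/m. *)
Definition affinity l th i : R :=
  if i.1 == l then (1 - delta ^+ 2) / (j%:R * 2) else weight th i.

Let jR : 0 < j%:R :> R. Proof. by rewrite ltr0n. Qed.

Lemma affinity_ge0 l th i : 0 <= affinity l th i.
Proof.
rewrite /affinity; case: ifP => _; last by apply: ltW; exact: weight_gt0.
rewrite divr_ge0 ?mulr_ge0 ?(ltW jR)// subr_ge0 exprn_ile1 ?(ltW delta_gt0)//.
by move: delta_le; lra.
Qed.

Lemma affinity_sqr l th i :
  affinity l th i ^+ 2 <= weight th i * weight (flip l th) i.
Proof.
have d1 : 0 <= 1 - delta ^+ 2 <= 1.
  by rewrite gerBl sqr_ge0 andbT subr_ge0 exprn_ile1 ?(ltW delta_gt0)//; move: delta_le; lra.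
rewrite /affinity !weightE /tilt /heavy /flip; case: ifP => il; last first.
  by rewrite expr2.
have le : ((1 - delta ^+ 2) / (j%:R * 2)) ^+ 2 <= (1 - delta ^+ 2) / (j%:R * 2) ^+ 2.
  rewrite expr_div_n ler_pM2r ?invr_gt0 ?exprn_gt0 ?mulr_gt0// expr2.
  by case/andP: d1 => d0 d1; rewrite ler_piMr.
apply: (le_trans le); rewrite le_eqVlt; apply/orP; left; apply/eqP.
by case: (i.2) (th i.1) => -[] /=; field; rewrite gt_eqF.
Qed.

Lemma affinity_sum l th : \sum_i affinity l th i = 1 - delta ^+ 2 / j%:R.
Proof.
rewrite -[X in _ = X - _](weight_sum delta j_gt0 th) !(sum_pair_index th).
rewrite (bigD1 l)//= [in RHS](bigD1 l)//=.
rewrite (eq_bigr (fun l' => weight th (l', th l') + weight th (l', ~~ th l'))); last first.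
  by move=> l' /negbTE l'l; rewrite /affinity /= l'l.
suff -> : affinity l th (l, th l) + affinity l th (l, ~~ th l) =
    weight th (l, th l) + weight th (l, ~~ th l) - delta ^+ 2 / j%:R by rewrite [LHS]addrAC.
rewrite /affinity /= !eqxx !weightE /tilt /heavy /=.
by case: (th l) => /=; field; rewrite gt_eqF.
Qed.

Lemma model_testing l th A : measurable A ->
  ((8^-1)%:E <= tuple_measure (model th) n (~` A) +
                tuple_measure (model (flip l th)) n A)%E.
Proof.
move=> mA.
apply: (two_point_testing (S := region) (w := weight th) (w' := weight (flip l th))
  (g := affinity l th)) => //.
- by move=> i; apply: measurable_edist_le; exact: ltW.
- by move=> i i' x; exact: region_inj.
- by move=> i; exact: weight_gt0.
- by move=> i; apply: ltW; exact: weight_gt0.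
- exact: affinity_ge0.
- exact: weight_sum.
- exact: weight_sum.
- exact: affinity_sqr.
- by rewrite affinity_sum gerBl divr_ge0 ?sqr_ge0// ltW.
- rewrite affinity_sum subKr mulrA ler_pdivrMr// mul1r.
  by move: delta_n; lra.
- exact: le_model_region.
- by move=> i B mB; exact: model_region_ratio.
Qed.

Variable chat : n.-tuple (d.-tuple R) -> k.-tuple (d.-tuple R).
Hypothesis mchat : measurable_fun setT chat.

Definition misfit_set th i : set (n.-tuple (d.-tuple R)) :=
  [set X | misfit Dl z th i (chat X)].

Lemma measurable_misfit_set th i : measurable (misfit_set th i).
Proof.
pose N l : set (k.-tuple (d.-tuple R)) := [set c | l \in near Dl z i c].
have mN l : measurable (N l).
  have -> : N l = [set: k.-tuple (d.-tuple R)] `&` (fun c => tnth c l) @^-1`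
      [set x | edist x (z i) <= 2 * Dl].
    by rewrite setTI; apply/seteqP; split => c; rewrite /N /= inE.
  apply: measurable_tnth => //; apply: measurable_edist_le.
  by rewrite mulr_ge0// ltW.
pose C : set (k.-tuple (d.-tuple R)) := [set c | (1 < #|near Dl z i c|)%N].
have mC : measurable C.
  have -> : C = \big[setU/set0]_(p : 'I_k * 'I_k | p.1 != p.2) (N p.1 `&` N p.2).
    apply/seteqP; split => c /=; rewrite -bigcup_seq_cond /=.
      move=> /card_gt1P[l [l' [lc l'c ll']]].
      by exists (l, l') => //=; rewrite mem_index_enum.
    by move=> [[l l'] /= /andP[_ ll'] [lc l'c]]; apply/card_gt1P; exists l, l'.
  by apply: bigsetU_measurable => p _; exact: measurableI.
have mpre : measurable (chat @^-1` C) by rewrite -[X in measurable X]setTI; exact: mchat.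
case: (boolP (heavy th i)) => hi.
  have -> : misfit_set th i = ~` (chat @^-1` C).
    apply/seteqP; split => X; rewrite /misfit_set /misfit /C /= hi eqb_id.
      by move/negP.
    by move/negP.
  exact: measurableC.
have -> : misfit_set th i = chat @^-1` C.
  by apply/seteqP; split => X; rewrite /misfit_set /misfit /C /= (negbTE hi) eqbF_neg negbK.
by [].
Qed.

Definition mass th i : R := fine (tuple_measure (model th) n (misfit_set th i)).

Lemma massE th i : (mass th i)%:E = tuple_measure (model th) n (misfit_set th i).
Proof.
rewrite /mass fineK// ge0_fin_numE//.
have := tuple_measure_box (model th) (fun _ : 'I_n => measurableT).
rewrite [X in _ = X](_ : _ = 1%E); last by apply: big1 => l _; exact: probability_setT.
move=> tT; apply: (@le_lt_trans _ _ 1%E); last exact: ltry.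
rewrite -tT; apply: le_measure; rewrite ?inE//; first exact: measurable_misfit_set.
by rewrite (_ : [set _ | _] = setT)//; apply/seteqP; split.
Qed.

(** Flipping the couple of i exchanges heavy and light for i, so that whether i is
    a misfit tests th against its flip. *)
Lemma mass_flip th i : 8^-1 <= mass th i + mass (flip i.1 th) i.
Proof.
rewrite -lee_fin EFinD !massE.
have -> : misfit_set th i = ~` misfit_set (flip i.1 th) i.
  apply/seteqP; split => X; rewrite /misfit_set /misfit /heavy /flip /= eqxx;
    by case: (_ < _)%N (i.2) (th i.1) => -[] [].
by apply: model_testing; exact: measurable_misfit_set.
Qed.

(** Average over all sign vectors, pairing each with its flip at the couple of i. *)
Lemma exists_large_mass : exists th : 'I_j -> bool, j%:R / 8 <= \sum_i mass th i.
Proof.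
pose F (f : {ffun 'I_j -> bool}) := \sum_i mass f i.
pose f0 : {ffun 'I_j -> bool} := [ffun=> true].
pose f := [arg max_(f > f0) F f]%O.
have fmax f' : F f' <= F f by rewrite /f; case: arg_maxP => // f1 _ /(_ f'); exact.
exists f; pose N : R := #|{ffun 'I_j -> bool}|%:R.
have N0 : 0 < N by rewrite ltr0n; apply/card_gt0P; exists f0.
have le_sum : \sum_f' F f' <= N * F f.
  rewrite mulr_natl -sumr_const; exact: ler_sum.
have half i : N / 16 <= \sum_(f' : {ffun 'I_j -> bool}) mass f' i.
  pose fl (f' : {ffun 'I_j -> bool}) : {ffun 'I_j -> bool} := [ffun l => flip i.1 f' l].
  have flE f' : (fl f' : 'I_j -> bool) = flip i.1 f' by apply/funext => l; rewrite ffunE.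
  have flK : involutive fl.
    move=> f'; apply/ffunP => l; rewrite !ffunE /flip !ffunE /flip.
    by case: eqP => // _; rewrite negbK.
  have : \sum_(f' : {ffun 'I_j -> bool}) 8^-1 <=
      \sum_(f' : {ffun 'I_j -> bool}) (mass f' i + mass (fl f') i).
    by apply: ler_sum => f' _; rewrite flE mass_flip.
  have swap : \sum_(f' : {ffun 'I_j -> bool}) mass (fl f') i =
    \sum_(f' : {ffun 'I_j -> bool}) mass f' i by rewrite [RHS](reindex_inj (inv_inj flK)).
  rewrite big_split/= swap sumr_const -[X in X <= _]mulr_natl -/N.
  by move: (\sum_f' _) => x; lra.
have : j%:R * 2 * (N / 16) <= \sum_f' F f'.
  rewrite exchange_big/=.
  apply: (@le_trans _ _ (\sum_(i : 'I_j * bool) N / 16)); last exact: ler_sum.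
  by rewrite sumr_const card_prod card_ord card_bool -[leRHS]mulr_natl natrM.
move/le_trans => /(_ _ le_sum); rewrite (_ : _ * (N / 16) = N * (j%:R / 8)); last by field.
by rewrite ler_pM2l.
Qed.

Lemma expected_loss_ge th : ((delta * price * \sum_i mass th i)%:E <=
  expected_loss (model th) chat (codebook th))%E.
Proof.
have dp0 : 0 <= delta * price by rewrite mulr_ge0 ?ltW ?price_gt0.
rewrite /expected_loss.
apply: (@le_trans _ _ (\int[tuple_measure (model th) n]_X
  \sum_i ((delta * price)%:E * (\1_(misfit_set th i) X)%:E))%E); last first.
  apply: ge0_le_integral_nonmeas => X.
    by apply: sume_ge0 => i _; rewrite mule_ge0// lee_fin.
  rewrite /loss risk_codebook//.
  rewrite (risk_model z d_gt0 j_gt0 Dl_gt0 delta_gt0 delta_le th (chat X)).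
  rewrite -EFinB sumEFin lee_fin -mulr_sumr lerBrDl.
  apply: le_trans (prisk_ge d_gt0 j_gt0 Dl_gt0 z_sep delta_gt0 delta_le th (chat X)).
  rewrite lerD2l natr_sum; apply: ler_wpM2l => //; apply: ler_sum => i _.
  rewrite indicE; case: (boolP (X \in misfit_set th i)) => [|/negP].
    by rewrite inE /misfit_set /= => ->.
  by rewrite inE /misfit_set /= => /negP/negbTE ->.
rewrite ge0_integral_sum//; last 2 first.
- by move=> i; apply: measurable_funeM; apply/measurable_EFinP; apply: measurable_indic;
    exact: measurable_misfit_set.
- by move=> i X _; rewrite mule_ge0// lee_fin.
rewrite mulr_sumr -sumEFin; apply: lee_sum => i _.
have mi : measurable_fun setT (fun X => (\1_(misfit_set th i) X)%:E : \bar R).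
  by apply/measurable_EFinP; apply: measurable_indic; exact: measurable_misfit_set.
rewrite (ge0_integralZl _ measurableT mi)//.
rewrite integral_indic//; last exact: measurable_misfit_set.
by rewrite setIT EFinM massE.
Qed.

End assouad.

(** * Choice of the parameters *)

Section parameters.
Context (R : realType) (d j n : nat) (M : R).
Hypotheses (d_gt0 : (0 < d)%N) (j_gt0 : (0 < j)%N) (M_gt0 : 0 < M).
Hypothesis jn : (9 * j <= 2 * n)%N.

Local Notation m := (j%:R * 2 : R).
Local Notation mu := (m `^ d%:R^-1 : R).
Local Notation sm := (Num.sqrt m : R).
Local Notation sn := (Num.sqrt n%:R : R).

Let jR : 0 < j%:R :> R. Proof. by rewrite ltr0n. Qed.
Let m_gt0 : 0 < m. Proof. by rewrite mulr_gt0. Qed.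
Let m_ge1 : 1 <= m.
Proof. by rewrite -natrM ler1n muln_gt0 j_gt0. Qed.
Let n_gt0 : (0 < n)%N.
Proof.
by rewrite lt0n; apply: contraTneq jn => ->; rewrite muln0 -ltnNge muln_gt0.
Qed.
Let nR : 0 < n%:R :> R. Proof. by rewrite ltr0n. Qed.
Let sn_gt0 : 0 < sn. Proof. by rewrite sqrtr_gt0. Qed.
Let sm_gt0 : 0 < sm. Proof. by rewrite sqrtr_gt0. Qed.
Let sm_sqr : sm ^+ 2 = m. Proof. by rewrite sqr_sqrtr// ltW. Qed.
Let sn_sqr : sn ^+ 2 = n%:R. Proof. by rewrite sqr_sqrtr// ltW. Qed.
Let mu_gt0 : 0 < mu. Proof. exact: powR_gt0. Qed.

Lemma mE : 2 * (j * 3)%N%:R / 3 = m.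
Proof. by rewrite natrM; field. Qed.

Lemma DeltaE : Delta d (j * 3) M = 5 * M / (32 * mu).
Proof. by rewrite /Delta mE. Qed.

(** The largest delta for which two sign vectors that differ in one couple cannot
    be told apart from the sample: 4 n delta^2 = m. *)
Definition gap : R := sm / (2 * sn).

Lemma gap_gt0 : 0 < gap.
Proof. by rewrite divr_gt0// mulr_gt0. Qed.

Lemma gap_sqr : 4 * n%:R * gap ^+ 2 = m.
Proof. by rewrite /gap expr_div_n exprMn sm_sqr sn_sqr; field; rewrite gt_eqF. Qed.

Lemma gap_le : gap <= 1 / 3.
Proof.
have le23 : sm <= 2 / 3 * sn.
  have a0 : 0 <= sm by exact: ltW.
  have b0 : 0 <= 2 / 3 * sn by rewrite mulr_ge0// ltW.
  rewrite -(ler_pXn2r (isT : (0 < 2)%N) a0 b0) exprMn sm_sqr sn_sqr.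
  have : (9 * j)%:R <= (2 * n)%:R :> R by rewrite ler_nat.
  by rewrite !natrM; move: (j%:R) (n%:R) => x y; lra.
rewrite /gap ler_pdivrMr ?mulr_gt0//; move: le23; move: (sm) (sn) => x y; lra.
Qed.

Lemma Delta_gt0 : 0 < Delta d (j * 3) M.
Proof. by rewrite DeltaE divr_gt0// mulr_gt0. Qed.

Lemma Delta_le : Delta d (j * 3) M <= 5 / 32 * M.
Proof.
have mu1 : 1 <= mu.
  by rewrite -[leLHS](powRr0 m); apply: ler_powR; rewrite ?invr_ge0.
rewrite DeltaE ler_pdivrMr ?mulr_gt0//.
have -> : 5 / 32 * M * (32 * mu) = 5 * M * mu by field.
by rewrite ler_peMr// mulr_ge0// ltW.
Qed.

Lemma mu_expr : mu ^+ d = m.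
Proof.
by rewrite -powR_mulrn ?(ltW mu_gt0)// -powRrM mulVf ?powRr1 ?(ltW m_gt0)// pnatr_eq0 -lt0n.
Qed.

(** Delta is (5M/32) m^(-1/d), so that 5 Delta is the radius of the ball
    times m^(-1/d). *)
Lemma Delta_packing :
  (j * 2)%N%:R * (5 * Delta d (j * 3) M) ^+ d <= (25 / 32 * M) ^+ d.
Proof.
have -> : 5 * Delta d (j * 3) M = 25 / 32 * M / mu.
  by rewrite DeltaE; field; rewrite gt_eqF.
by rewrite expr_div_n mu_expr natrM mulrCA divff ?mulr1// gt_eqF.
Qed.

Lemma separationE :
  (5 * M) ^+ 2 / (4 * (32 * m `^ (4^-1 + d%:R^-1)) ^+ 2) / sn =
  2 * gap * price j (Delta d (j * 3) M).
Proof.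
have m0 : m != 0 by rewrite gt_eqF.
rewrite powRD; last by rewrite m0 implybT.
have q2 : (m `^ 4^-1) ^+ 2 = sm.
  rewrite -powR_mulrn ?powR_ge0// -powRrM (_ : 4^-1 * 2%:R = 2^-1); last by field.
  by rewrite powR12_sqrt// ltW.
rewrite /price DeltaE /gap [(32 * (_ * _)) ^+ 2]exprMn [(_ * mu) ^+ 2]exprMn q2.
rewrite -[X in _ = _ * (_ / (4 * X))]sm_sqr.
by field; rewrite !gt_eqF.
Qed.

(** The ratio of delta * Delta^2 / 64 to the rate involves sqrt m / m^(2/d) on one
    side and sqrt k / k^(2/d) on the other, and m <= k <= 25/16 m; the factor
    m^(-2/d) >= k^(-2/d) goes the right way for every d. *)
Lemma rateE : 5 / 32 ^+ 3 * M ^+ 2 *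
    (Num.sqrt ((j * 3)%N%:R `^ (1 - 4 / d%:R)) / sn) <=
  gap * price j (Delta d (j * 3) M) * (j%:R / 8).
Proof.
pose K : R := (j * 3)%N%:R; have K0 : 0 < K by rewrite ltr0n muln_gt0 j_gt0.
pose nu : R := K `^ d%:R^-1; have nu0 : 0 < nu by exact: powR_gt0.
have KE : Num.sqrt (K `^ (1 - 4 / d%:R)) = Num.sqrt K / nu ^+ 2.
  have -> : K `^ (1 - 4 / d%:R) = K / nu ^+ 4.
    rewrite powRD; last by apply/implyP => _; rewrite gt_eqF.
    rewrite powRr1 ?(ltW K0)// powRN; congr (_ / _).
    by rewrite -powR_mulrn ?(ltW nu0)// -powRrM mulrC.
  rewrite sqrtrM ?(ltW K0)// sqrtrV ?exprn_ge0 ?(ltW nu0)//.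
  have -> : nu ^+ 4 = (nu ^+ 2) ^+ 2 by rewrite -exprM.
  by rewrite sqrtr_sqr ger0_norm// exprn_ge0// ltW.
rewrite -/K KE.
have munu : mu <= nu.
  apply: ge0_ler_powR; rewrite ?nnegrE ?invr_ge0 ?(ltW m_gt0) ?(ltW K0)//.
  by rewrite /K natrM ler_pM2l// ler_nat.
have sK : Num.sqrt K <= 5 / 4 * sm.
  have a0 : 0 <= Num.sqrt K by exact: sqrtr_ge0.
  have b0 : 0 <= 5 / 4 * sm by rewrite mulr_ge0// ltW.
  rewrite -(ler_pXn2r (isT : (0 < 2)%N) a0 b0) exprMn sm_sqr sqr_sqrtr ?(ltW K0)//.
  by rewrite /K natrM; move: jR; move: (j%:R) => x; lra.
have -> : gap * price j (Delta d (j * 3) M) * (j%:R / 8) =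
   5 / 32 ^+ 3 * M ^+ 2 * ((5 / 4 * sm) / mu ^+ 2 / sn).
  by rewrite /price DeltaE /gap; field; rewrite !gt_eqF.
apply: ler_wpM2l; first by rewrite mulr_ge0 ?sqr_ge0// divr_ge0// exprn_ge0.
apply: ler_wpM2r; first by rewrite invr_ge0 ltW.
apply: ler_pM => //; first by rewrite invr_ge0 exprn_ge0// ltW.
rewrite lef_pV2 ?posrE ?exprn_gt0//.
by rewrite (ler_pXn2r (isT : (0 < 2)%N) (ltW mu_gt0) (ltW nu0)).
Qed.

End parameters.

(** * The lower bound *)

Theorem proposition3p1 (R : realType) :
  exists c0 : R, 0 < c0 /\
    forall (d k n : nat) (M : R),
      (1 <= d)%N -> 0 < M -> (3 <= k)%N -> (3 %| k)%N -> (3 * k <= 2 * n)%N ->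
    let m : R := 2 * k%:R / 3 in
    let c1 : R :=
      (5 * M) ^+ 2 / (4 * (32 * m `^ (4^-1 + d%:R^-1)) ^+ 2) in
    forall chat : n.-tuple (d.-tuple R) -> k.-tuple (d.-tuple R),
      measurable_fun [set: n.-tuple (d.-tuple R)] chat ->
    ((c0 * M ^+ 2 * (Num.sqrt (k%:R `^ (1 - 4 / d%:R)) / Num.sqrt n%:R))%:E
      <= ereal_sup [set e | exists (P : probability (d.-tuple R) R)
                                   (cstar : k.-tuple (d.-tuple R)),
           [/\ class_D k M (c1 / Num.sqrt n%:R) P, optimal P cstar &
               e = expected_loss P chat cstar]])%E.
Proof.
exists (5 / 32 ^+ 3); split; first by rewrite divr_gt0// exprn_gt0.
move=> d k n M d_gt0 M_gt0 k3 /dvdnP[j kE]; subst k.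
have j_gt0 : (0 < j)%N by move: k3; case: (j).
move=> kn m c1 chat mchat.
have jn : (9 * j <= 2 * n)%N by move: kn; lia.
have m2 : m = j%:R * 2 by rewrite /m mE.
set Dl := Delta d (j * 3) M; set delta := gap R j n.
have Dl_gt0 : 0 < Dl by exact: Delta_gt0.
have delta_gt0 : 0 < delta by exact: gap_gt0.
have delta_le : delta <= 1 / 3 by exact: gap_le.
have r_gt0 : 0 < 25 / 32 * M by rewrite mulr_gt0.
have D5 : 0 < 5 * Dl by rewrite mulr_gt0.
have [z0 [z0_ball z0_sep]] :=
  packing_ball d_gt0 r_gt0 D5 (Delta_packing M d_gt0 j_gt0).
have card_idx : #|{: 'I_j * bool}| = (j * 2)%N by rewrite card_prod card_ord card_bool.
pose z (i : 'I_j * bool) := z0 (cast_ord card_idx (enum_rank i)).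
have z_sep i i' : i != i' -> 5 * Dl <= edist (z i) (z i').
  by move=> ii'; apply: z0_sep; rewrite (inj_eq (@cast_ord_inj _ _ _)) (inj_eq enum_rank_inj).
have delta_n : 4 * n%:R * delta ^+ 2 <= j%:R * 2 by rewrite gap_sqr.
have [th th_mass] := exists_large_mass d_gt0 j_gt0 Dl_gt0 z_sep delta_gt0 delta_le delta_n mchat.
set P := model z d_gt0 j_gt0 Dl_gt0 delta_gt0 delta_le th.
apply: (@le_trans _ _ (expected_loss P chat (codebook Dl z th))); last first.
  apply: ereal_sup_ubound; exists P, (codebook Dl z th); split=> //.
    rewrite /c1 m2 separationE//; apply: model_class_D => //; last exact: Delta_le.
    by move=> i; exact: z0_ball.
  exact: optimal_codebook.
apply: le_trans (expected_loss_ge d_gt0 j_gt0 Dl_gt0 z_sep delta_gt0 delta_le mchat th).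
rewrite lee_fin; apply: (le_trans (rateE d M j_gt0 jn)).
by apply: ler_wpM2l => //; rewrite mulr_ge0 ?(ltW delta_gt0)// ltW// price_gt0.
Qed.
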